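(* The HDG scheme for the Cahn–Hilliard equation (with either choice $f^n(u_h^n)=(u_h^n)^3-u_h^n$ or $f^n(u_h^n)=(u_h^n)^3-u_h^{n-1}$) admits at least one solution; that is, there exist $u_h^0\in W_h$ and, for $n=1,\dots,N$, $(\bm p_h^n,\phi_h^n,\widehat\phi_h^n),(\bm q_h^n,u_h^n,\widehat u_h^n)\in\bm V_h\times W_h\times M_h$ satisfying $$(\partial_t^+u_h^n,w_1)_{\mathcal T_h}+\mathcal A(\bm p_h^n,\phi_h^n,\widehat\phi_h^n;\bm r_1,w_1,\mu_1)=0,$$ $$(\epsilon^{-1}f^n(u_h^n),w_2)_{\mathcal T_h}+\epsilon\mathcal A(\bm q_h^n,u_h^n,\widehat u_h^n;\bm r_2,w_2,\mu_2)-(\phi_h^n,w_2)_{\mathcal T_h}=0,$$ $$(u_h^0,w_3)_{\mathcal T_h}-(u^0,w_3)_{\mathcal T_h}=0,$$ for all $(\bm r_1,w_1,\mu_1),(\bm r_2,w_2,\mu_2)\in\bm V_h\times W_h\times M_h$ and $w_3\in W_h$.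
   Context: $\Omega\subset\mathbb R^d$ ($d=2,3$) is a bounded polygonal/polyhedral domain with Lipschitz boundary, $\epsilon>0$, $T>0$, $u^0\in L^2(\Omega)$ the given initial datum, $N\ge1$ an integer, $\Delta t=T/N$, $\partial_t^+u_h^n=(u_h^n-u_h^{n-1})/\Delta t$. $\mathcal T_h$ is a shape-regular, quasi-uniform simplicial triangulation of $\Omega$, $h_K$ the diameter of $K$, $\mathcal E_h$ the set of all faces. $(w,v)_{\mathcal T_h}=\sum_K\int_Kwv$, $\langle\zeta,\rho\rangle_{\partial\mathcal T_h}=\sum_K\int_{\partial K}\zeta\rho$; differential operators act elementwise; $\bm n$ is the outward unit normal to $K$. For an integer $k\ge0$: $\bm V_h=\{\bm v\in[L^2(\Omega)]^d:\bm v|_K\in[\mathcal P^k(K)]^d\ \forall K\}$, $W_h=\{w\in L^2(\Omega):w|_K\in\mathcal P^{k+1}(K)\ \forall K\}$, $M_h=\{\mu\in L^2(\mathcal E_h):\mu|_E\in\mathcal P^k(E)\ \forall E\in\mathcal E_h\}$. $\Pi_k^\partial$ is the $L^2$ projection onto $\mathcal P^k(E)$ on each face $E$ of each $K$ (applied to traces from $K$). The operator $\mathcal A$ is $$\mathcal A(\bm q_h,u_h,\widehat u_h;\bm r_h,w_h,\mu_h)=(\bm q_h,\bm r_h)_{\mathcal T_h}-(u_h,\nabla\cdot\bm r_h)_{\mathcal T_h}+\langle\widehat u_h,\bm r_h\cdot\bm n\rangle_{\partial\mathcal T_h}+(\nabla\cdot\bm q_h,w_h)_{\mathcal T_h}-\langle\bm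 q_h\cdot\bm n,\mu_h\rangle_{\partial\mathcal T_h}+\langle h_K^{-1}(\Pi_k^\partial u_h-\widehat u_h),\Pi_k^\partial w_h-\mu_h\rangle_{\partial\mathcal T_h}.$$ *)

(* Defs.v *)
From HB Require Import structures.
From mathcomp Require Import all_boot all_order all_algebra.
From mathcomp Require Import all_classical all_reals all_analysis.
From mathcomp Require mpoly.
Import (canonicals, coercions) mpoly.

Set Implicit Arguments.
Unset Strict Implicit.
Unset Printing Implicit Defensive.

Import Order.TTheory GRing.Theory Num.Theory.
Import numFieldNormedType.Exports.

Local Open Scope classical_set_scope.
Local Open Scope ring_scope.

(* Lebesgue measure on R^n, on the sigma-algebra generated by the coordinates
   (the Borel sigma-algebra).  Every L^2 class has a Borel representative. *)

Definition rV_display : measure_display. Proof. exact: default_measure_display. Qed.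

Section rV_measurable.
Context (R : realType) (n : nat).

Definition rV_measurable : set (set 'rV[R]_n) :=
  g_sigma_preimage (fun i (x : 'rV[R]_n) => x ord0 i : measurableTypeR R).

Let rV_measurable0 : rV_measurable set0.
Proof. exact: sigma_algebra0. Qed.

Let rV_measurableC A : rV_measurable A -> rV_measurable (~` A).
Proof. exact: sigma_algebraC. Qed.

Let rV_measurable_bigcup (F : (set 'rV[R]_n)^nat) :
  (forall i, rV_measurable (F i)) -> rV_measurable (\bigcup_i F i).
Proof. exact: sigma_algebra_bigcup. Qed.

HB.instance Definition _ := @isMeasurable.Build rV_display
  'rV[R]_n rV_measurable rV_measurable0 rV_measurableC rV_measurable_bigcup.

End rV_measurable.

Section rV_measurable_fun.
Context (R : realType).

Lemma measurable_rV_coord n (i : 'I_n) :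
  measurable_fun [set: 'rV[R]_n] (fun x => x ord0 i : measurableTypeR R).
Proof.
move=> _ Y mY; rewrite setTI; apply: sub_sigma_algebra => /=.
rewrite -bigcup_seq/=; exists i => /=; first by rewrite mem_index_enum.
by exists Y => //; rewrite setTI.
Qed.

Lemma measurable_fun_rVP d (T : measurableType d) n (f : T -> 'rV[R]_n) :
  measurable_fun [set: T] f <->
  forall i, measurable_fun [set: T] (fun t => f t ord0 i : measurableTypeR R).
Proof.
split=> [mf i|mf].
  exact: (measurableT_comp (measurable_rV_coord i) mf).
suff: g_sigma_preimage (fun i t => f t ord0 i : measurableTypeR R)
    `<=` measurable.
  rewrite (g_sigma_preimage_comp (fun i (x : 'rV[R]_n) =>
    x ord0 i : measurableTypeR R)) => prefS _ A mA.
  by apply: prefS; exists A.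
apply: smallest_sub; first exact: sigma_algebra_measurable.
move=> A; rewrite -bigcup_seq => -[i _] [B mB <-]; exact: mf.
Qed.

Definition rV_cons n (x : measurableTypeR R * 'rV[R]_n) : 'rV[R]_n.+1 :=
  \row_i (if unlift ord0 i is Some j then x.2 ord0 j else x.1).

Definition rV_uncons n (x : 'rV[R]_n.+1) : measurableTypeR R * 'rV[R]_n :=
  (x ord0 ord0, \row_j x ord0 (lift ord0 j)).

Lemma rV_consK n : cancel (@rV_cons n) (@rV_uncons n).
Proof.
move=> [a x]; congr pair; first by rewrite mxE unlift_none.
by apply/rowP => j; rewrite !mxE liftK.
Qed.

Lemma rV_unconsK n : cancel (@rV_uncons n) (@rV_cons n).
Proof.
by move=> x; apply/rowP => i; rewrite mxE; case: unliftP => [j ->|->]; rewrite ?mxE.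
Qed.

Lemma measurable_rV_cons n : measurable_fun [set: _] (@rV_cons n).
Proof.
apply/measurable_fun_rVP => i.
case: (unliftP ord0 i) => [j ->|->].
  rewrite (_ : (fun _ => _) = (fun y : 'rV[R]_n => y ord0 j : measurableTypeR R) \o snd).
    by apply: measurableT_comp; [exact: measurable_rV_coord|exact: measurable_snd].
  by apply/funext => x /=; rewrite mxE liftK.
rewrite (_ : (fun _ => _) = fst); first exact: measurable_fst.
by apply/funext => x /=; rewrite mxE unlift_none.
Qed.

Lemma measurable_rV_uncons n : measurable_fun [set: _] (@rV_uncons n).
Proof.
apply/measurable_fun_pair; first exact: measurable_rV_coord.
apply/measurable_fun_rVP => i.
rewrite (_ : (fun _ => _) = (fun x : 'rV[R]_n.+1 =>
  x ord0 (lift ord0 i) : measurableTypeR R)); first exact: measurable_rV_coord.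
by apply/funext => x; rewrite mxE.
Qed.

End rV_measurable_fun.

Section rV_lebesgue_step.
Context (R : realType) (n : nat).
Variable mu : {sigma_finite_measure set 'rV[R]_n -> \bar R}.

Definition rV_lebesgue_step : set 'rV[R]_n.+1 -> \bar R :=
  pushforward (@lebesgue_measure R \x mu)%E (@rV_cons R n).

Let rV_lebesgue_step0 : rV_lebesgue_step set0 = 0%E.
Proof. by rewrite /rV_lebesgue_step /pushforward preimage_set0 measure0. Qed.

Let rV_lebesgue_step_ge0 A : (0 <= rV_lebesgue_step A)%E.
Proof. by rewrite /rV_lebesgue_step /pushforward; exact: measure_ge0. Qed.

Let measurable_preimage_cons A : measurable A -> measurable (@rV_cons R n @^-1` A).
Proof. by move=> mA; rewrite -[X in measurable X]setTI; exact: measurable_rV_cons. Qed.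

Let rV_lebesgue_step_sigma_additive : semi_sigma_additive rV_lebesgue_step.
Proof.
move=> F mF tF mUF; rewrite /rV_lebesgue_step /pushforward preimage_bigcup.
apply: measure_semi_sigma_additive.
- by move=> k; exact: measurable_preimage_cons.
- apply/trivIsetP => /= i j _ _ ij; rewrite -preimage_setI.
  by move/trivIsetP : tF => /(_ _ _ _ _ ij) ->//; rewrite preimage_set0.
- by rewrite -preimage_bigcup; exact: measurable_preimage_cons.
Qed.

HB.instance Definition _ := isMeasure.Build _ _ _ rV_lebesgue_step
  rV_lebesgue_step0 rV_lebesgue_step_ge0 rV_lebesgue_step_sigma_additive.

Let rV_lebesgue_step_sigma_finite : sigma_finite setT rV_lebesgue_step.
Proof.
have [F TF Foo] : sigma_finite setT (@lebesgue_measure R \x mu)%E.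
  have /sigma_finiteP[F [TF ndF Foo]] := sigma_finiteT (@lebesgue_measure R).
  have /sigma_finiteP[G [TG ndG Goo]] := sigma_finiteT mu.
  exists (fun k => F k `*` G k).
    rewrite -setXTT TF TG predeqE => -[x y]; split.
      move=> [/= [k _ Fkx] [l _ Gly]]; exists (maxn k l) => //; split.
      - by move: x Fkx; exact/subsetPset/ndF/leq_maxl.
      - by move: y Gly; exact/subsetPset/ndG/leq_maxr.
    by move=> [k _ []/= ? ?]; split; exists k.
  move=> k; have [? ?] := Foo k; have [? ?] := Goo k.
  split; first exact: measurableX.
  by rewrite product_measure1E// lte_mul_pinfty// ge0_fin_numE.
exists (fun k => @rV_uncons R n @^-1` F k).
  by rewrite -preimage_bigcup -TF preimage_setT.
move=> k; have [mFk Fk] := Foo k; split.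
  by rewrite -[X in measurable X]setTI; exact: measurable_rV_uncons.
rewrite /rV_lebesgue_step /pushforward -comp_preimage.
by rewrite (_ : _ \o _ = id) //; apply/funext; exact: rV_consK.
Qed.

HB.instance Definition _ := Measure_isSigmaFinite.Build _ _ _ rV_lebesgue_step
  rV_lebesgue_step_sigma_finite.

End rV_lebesgue_step.

Fixpoint rV_lebesgue (R : realType) n : {sigma_finite_measure set 'rV[R]_n -> \bar R} :=
  if n is m.+1 then rV_lebesgue_step (rV_lebesgue R m) else \d_(0 : 'rV[R]_0).

Section vectors.
Context (R : realType) (n : nat).
Implicit Types x y : 'rV[R]_n.

Definition dotp x y : R := \sum_i x ord0 i * y ord0 i.

(* The norm provided by the library on 'rV[R]_n is the sup norm. *)
Definition enorm x : R := Num.sqrt (dotp x x).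

Definition square_integrable (D : set 'rV[R]_n) (f : 'rV[R]_n -> R) : Prop :=
  measurable_fun D f /\
  (rV_lebesgue R n).-integrable D (fun x => (f x ^+ 2)%:E).

(* f coincides on D with a polynomial of total degree at most k;
   mpoly.msize is 1 + the total degree. *)
Definition polynomial_on (k : nat) (D : set 'rV[R]_n) (f : 'rV[R]_n -> R) : Prop :=
  exists p : mpoly.mpoly n R, (mpoly.msize p <= k.+1)%N /\
    forall x, D x -> f x = mpoly.meval (fun i => x ord0 i) p.

End vectors.

Section simplices.
Context (R : realType) (n : nat) (V : finType) (pos : V -> 'rV[R]_n).
Implicit Types S : {set V}.

Definition hull S : set 'rV[R]_n := [set x | exists a : V -> R,
  [/\ forall v, v \in S -> 0 <= a v,
      \sum_(v in S) a v = 1 &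
      x = \sum_(v in S) a v *: pos v]].

(* the relative interior of the simplex with vertex set S *)
Definition open_simplex S : set 'rV[R]_n := [set x | exists a : V -> R,
  [/\ forall v, v \in S -> 0 < a v,
      \sum_(v in S) a v = 1 &
      x = \sum_(v in S) a v *: pos v]].

Definition affinely_independent S : Prop := forall a : V -> R,
  \sum_(v in S) a v = 0 -> \sum_(v in S) a v *: pos v = 0 ->
  forall v, v \in S -> a v = 0.

Definition union_of_hulls (P : {set {set V}}) : set 'rV[R]_n :=
  [set x | exists2 S, S \in P & hull S x].

Definition diam S : R :=
  sup [set r | exists x y, [/\ hull S x, hull S y & r = enorm (x - y)]].

(* the diameter of the largest ball contained in the simplex *)
Definition indiam S : R := sup [set r | 0 <= r /\
  exists c, [set y | enorm (y - c) <= r / 2] `<=` hull S].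

End simplices.

Section domains.
Context (R : realType) (n : nat).
Implicit Types Omega : set 'rV[R]_n.+1.

Definition polyhedral Omega : Prop :=
  exists (V : finType) (pos : V -> 'rV[R]_n.+1) (P : {set {set V}}),
    closure Omega = union_of_hulls pos P.

(* Up to an orthogonal change of coordinates Q, Omega is locally the open
   epigraph of a Lipschitz function of the last n coordinates. *)
Definition Lipschitz_boundary Omega : Prop :=
  forall x, (closure Omega `\` Omega°) x ->
  exists (Q : 'M[R]_n.+1) (g : 'rV[R]_n -> R),
    [/\ Q *m Q^T = 1%:M,
        [lipschitz g z | z in [set: 'rV[R]_n]] &
        \forall y \near x,
          Omega y <-> g (col' ord0 (y *m Q)) < (y *m Q) ord0 ord0].

Definition polyhedral_Lipschitz_domain Omega : Prop :=
  [/\ Omega !=set0, open Omega & connected Omega] /\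
  [/\ bounded_set Omega, polyhedral Omega & Lipschitz_boundary Omega].

End domains.

(* A mesh of R^(n+1): a simplex is given by the finite set of its vertices. *)
Record mesh (R : realType) (n : nat) := Mesh {
  vertex : finType;
  pos : vertex -> 'rV[R]_n.+1;
  cells : {set {set vertex}}
}.

Section mesh_geometry.
Context (R : realType) (n : nat) (T : mesh R n).
Local Notation V := (vertex T).
Local Notation point := 'rV[R]_n.+1.
Implicit Types (K E : {set V}).

Definition faces_of K : {set {set V}} :=
  finset (fun E : {set V} => (E \subset K) && (#|E| == n.+1)).

Definition faces : {set {set V}} :=
  finset (fun E : {set V} => [exists K in cells T, E \in faces_of K]).

(* The third condition is conformity: two closed cells meet along the face
   spanned by their common vertices, or not at all. *)
Definition triangulation (Omega : set point) : Prop :=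
  [/\ forall K, K \in cells T -> #|K| = n.+2 /\ affinely_independent (@pos _ _ T) K,
      closure Omega = union_of_hulls (@pos _ _ T) (cells T),
      forall K K', K \in cells T -> K' \in cells T ->
        hull (@pos _ _ T) K `&` hull (@pos _ _ T) K' =
        hull (@pos _ _ T) (K :&: K')%SET &
      forall K, K \in cells T -> open_simplex (@pos _ _ T) K `<=` Omega].

Definition h K : R := diam (@pos _ _ T) K.

Definition shape_regular (sigma : R) : Prop :=
  forall K, K \in cells T -> h K <= sigma * indiam (@pos _ _ T) K.

Definition quasi_uniform (tau : R) : Prop :=
  forall K K', K \in cells T -> K' \in cells T -> h K <= tau * h K'.

(* Cells and faces enter the integrals and the discrete spaces through their
   (relatively) open simplices, which are pairwise disjoint. *)
Definition cell K : set point := open_simplex (@pos _ _ T) K.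
Definition face E : set point := open_simplex (@pos _ _ T) E.

Definition outward_normal K E : point := xget 0 [set nu : point |
  [/\ enorm nu = 1,
      forall a b, a \in E -> b \in E -> dotp (pos a - pos b) nu = 0 &
      forall a b, a \in K -> a \notin E -> b \in E -> dotp (pos a - pos b) nu < 0]].

Definition ref_simplex : set 'rV[R]_n :=
  [set s | (forall i, 0 < s ord0 i) /\ \sum_i s ord0 i < 1].

Definition face_vertex E (i : nat) : point := nth 0 [seq pos v | v <- enum E] i.

Definition face_jacobian E : 'M[R]_(n, n.+1) :=
  \matrix_(i < n) (face_vertex E i.+1 - face_vertex E 0).

(* affine parametrization of the face E by the reference simplex *)
Definition face_map E (s : 'rV[R]_n) : point :=
  face_vertex E 0 + s *m face_jacobian E.

(* the surface integral over E, with the Gram determinant as area element *)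
Definition face_integral E (g : point -> R) : R :=
  Num.sqrt (\det (face_jacobian E *m (face_jacobian E)^T)) *
  (\int[rV_lebesgue R n]_(s in ref_simplex) g (face_map E s)).

Definition face_square_integrable E (g : point -> R) : Prop :=
  square_integrable ref_simplex (g \o face_map E).

End mesh_geometry.

Section hdg.
Context (R : realType) (n : nat) (Omega : set 'rV[R]_n.+1) (T : mesh R n).
Context (k : nat).
Local Notation V := (vertex T).
Local Notation point := 'rV[R]_n.+1.
Implicit Types (K E : {set V}) (u w mu : point -> R) (q r : point -> point).

Definition Vh : set (point -> point) := [set q | forall i,
  square_integrable Omega (fun x => q x ord0 i) /\
  forall K, K \in cells T -> polynomial_on k (cell K) (fun x => q x ord0 i)].

Definition Wh : set (point -> R) := [set w |
  square_integrable Omega w /\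
  forall K, K \in cells T -> polynomial_on k.+1 (cell K) w].

Definition Mh : set (point -> R) := [set mu | forall E, E \in faces T ->
  face_square_integrable E mu /\ polynomial_on k (face E) mu].

(* the trace on the boundary of K of w restricted to K *)
Definition trace K w : point -> R :=
  fun x => lim (w y @[y --> within (cell K) (nbhs x)]).

Definition normal_trace K E q : point -> R := fun x =>
  dotp (\row_i trace K (fun y => q y ord0 i) x) (outward_normal K E).

Definition divergence q : point -> R := fun x =>
  \sum_i 'D_(delta_mx ord0 i) (fun y => q y ord0 i) x.

(* the L^2(E) projection onto polynomials of degree at most k; only its values
   on E are determined *)
Definition face_projection E w : point -> R := xget (cst 0) [set p |
  polynomial_on k (face E) p /\
  forall z, polynomial_on k (face E) z ->
    face_integral E (fun x => (p x - w x) * z x) = 0].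

Definition inner u w : R :=
  \sum_(K in cells T) \int[rV_lebesgue R n.+1]_(x in cell K) (u x * w x).

Definition vinner q r : R :=
  \sum_(K in cells T) \int[rV_lebesgue R n.+1]_(x in cell K) dotp (q x) (r x).

(* the integrands may depend on the cell K and on the face E of K *)
Definition boundary_inner (zeta rho : {set V} -> {set V} -> point -> R) : R :=
  \sum_(K in cells T) \sum_(E in faces_of K)
    face_integral E (fun x => zeta K E x * rho K E x).

Definition Aform q u (uhat : point -> R) r w mu : R :=
  vinner q r
  - inner u (divergence r)
  + boundary_inner (fun _ _ => uhat) (fun K E => normal_trace K E r)
  + inner (divergence q) w
  - boundary_inner (fun K E => normal_trace K E q) (fun _ _ => mu)
  + boundary_inner
      (fun K E x => (h K)^-1 * (face_projection E (trace K u) x - uhat x))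
      (fun K E x => face_projection E (trace K w) x - mu x).

End hdg.

Variant nonlinearity := fully_implicit | semi_implicit.

(* f^n as a function of u_h^n and u_h^(n-1) *)
Definition potential (R : realType) (f : nonlinearity) (un uprev : R) : R :=
  match f with
  | fully_implicit => un ^+ 3 - un
  | semi_implicit => un ^+ 3 - uprev
  end.

(* Main.v *)
Require Import Defs.
From mathcomp Require Import all_boot all_order all_algebra.
From mathcomp Require Import all_classical all_reals all_analysis.
From mathcomp Require Import measurable_realfun ring lra.
From mathcomp Require mpoly.
Import (canonicals, coercions) mpoly.
Import Order.TTheory GRing.Theory Num.Theory.
Import numFieldNormedType.Exports.
Set Implicit Arguments.
Unset Strict Implicit.
Unset Printing Implicit Defensive.
Local Open Scope classical_set_scope.
Local Open Scope ring_scope.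

(** One time step of the scheme is the first-order condition of a finite
    dimensional minimisation problem, which is why it can be solved.

    With y = (u, uhat) and z = (w, mu), the form A reads
      (q, r) - B(y; r) + B(z; q) + s(y, z),
    where B pairs the scalar unknowns with the fluxes and s is the
    stabilisation.  The equation tested with r says that q is the Riesz
    representative Qy of B(y; .), which leaves the symmetric positive
    semidefinite form a(y, z) = (Qy, Qz) + s(y, z).  Projecting (u, 0) onto
    the face unknowns along a then eliminates uhat.  What remains is a
    symmetric positive semidefinite operator L on W_h such that A, evaluated
    at u completed by its q and uhat, is (L u, w) for all test functions
    ([condensation], [Aform_condensation]).

    A time step starting from u' therefore asks for u and phi in W_h with
      u - u' + dt L phi = 0   and   phi = eps^-1 P f(u) + eps L u,
    where P is the L^2 projection onto W_h.  This is a minimising movement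
    in the dual metric of L.  Look for u in the form
    u' - dt L psi and minimise
      dt/2 (L psi, psi) + eps/2 (L u, u) + eps^-1 E(u),
    where E is a primitive of f integrated over the cells.  Stationarity reads
    L (psi - phi) = 0, and then u = u' - dt L phi.  The quartic term makes E
    bounded below by a positive multiple of (u, u) up to a constant, so a
    minimiser exists ([implicit_gradient_step], [energy_coercive],
    [energy_gradient]).

    The discrete functions are functions on the whole space which are
    constrained only on the cells or on the faces, and the forms are bilinear
    on the discrete spaces only.  The linear algebra is thus done for
    semi-inner products on subspaces of function spaces, with orthonormal
    bases modulo null vectors ([orthonormal_basis_exists]).  Every form must
    vanish on these null vectors.  In the cells this holds because a
    polynomial of zero L^2 norm on a nonempty open set vanishes there, hence
    so do its derivatives in the cell and its traces ([L2_polyfun_eq0],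
    [forms_null]). *)

(** * Semi-inner products on subspaces *)

Section subspaces.
Context (R : realType) (X : lmodType R).
Implicit Types (S : set X) (g : X -> X -> R) (l : X -> R) (x y z : X).

Definition linear_subspace S : Prop :=
  S 0 /\ forall a x y, S x -> S y -> S (a *: x + y).

(** Integrals are additive only on integrable functions and traces only on
    piecewise polynomials, so linearity is always relative to a subspace. *)
Definition linear_on S l : Prop :=
  forall a x y, S x -> S y -> l (a *: x + y) = a * l x + l y.

Definition semi_inner S g : Prop :=
  [/\ forall x y, S x -> S y -> g x y = g y x,
      forall y, S y -> linear_on S (g^~ y) &
      forall x, S x -> 0 <= g x x].

Definition comb r (e : 'I_r -> X) (c : 'rV[R]_r) : X := \sum_i c ord0 i *: e i.

(** A basis modulo the null vectors of g: the remainder of the orthogonal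
    expansion has zero seminorm but need not vanish. *)
Definition orthonormal_basis S g r (e : 'I_r -> X) : Prop :=
  [/\ forall i, S (e i),
      forall i j, g (e i) (e j) = (i == j)%:R &
      forall x, S x ->
        let x' := x - comb e (\row_i g x (e i)) in g x' x' = 0].

Lemma linear_subspaceD S x y : linear_subspace S -> S x -> S y -> S (x + y).
Proof. by move=> [_ SZ] Sx Sy; rewrite -[x]scale1r; exact: SZ. Qed.

Lemma linear_subspaceZ S a x : linear_subspace S -> S x -> S (a *: x).
Proof. by move=> [S0 SZ] Sx; rewrite -[_ *: _]addr0; exact: SZ. Qed.

Lemma linear_subspaceB S x y : linear_subspace S -> S x -> S y -> S (x - y).
Proof.
by move=> subS Sx Sy; rewrite -scaleN1r; apply: linear_subspaceD => //;
  exact: linear_subspaceZ.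
Qed.

Lemma linear_subspace_sum S (I : finType) (F : I -> X) : linear_subspace S ->
  (forall i, S (F i)) -> S (\sum_i F i).
Proof.
move=> subS SF; elim/big_rec: _ => [|i x _ Sx]; first by case: subS.
exact: linear_subspaceD.
Qed.

Lemma linear_subspace_comb S r (e : 'I_r -> X) c : linear_subspace S ->
  (forall i, S (e i)) -> S (comb e c).
Proof. by move=> subS Se; apply: linear_subspace_sum => // i;
  exact: linear_subspaceZ. Qed.

Lemma comb_linear r (e : 'I_r -> X) a c d :
  comb e (a *: c + d) = a *: comb e c + comb e d.
Proof.
rewrite /comb scaler_sumr -big_split /=; apply: eq_bigr => i _.
by rewrite !mxE scalerDl scalerA.
Qed.

Lemma comb0 r (e : 'I_r -> X) : comb e 0 = 0.
Proof. by rewrite /comb big1// => i _; rewrite mxE scale0r. Qed.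

Lemma combD r (e : 'I_r -> X) c d : comb e (c + d) = comb e c + comb e d.
Proof. by rewrite -[c]scale1r comb_linear !scale1r. Qed.

Lemma combZ r (e : 'I_r -> X) a c : comb e (a *: c) = a *: comb e c.
Proof. by rewrite -[_ *: _]addr0 comb_linear comb0 addr0. Qed.

Lemma combB r (e : 'I_r -> X) c d : comb e (c - d) = comb e c - comb e d.
Proof. by rewrite combD -[- d]scaleN1r combZ scaleN1r. Qed.

Section linear_on.
Context S l (subS : linear_subspace S) (linl : linear_on S l).

Lemma linear_on0 : l 0 = 0.
Proof.
have [S0 _] := subS; have := linl 1 S0 S0.
by rewrite scaler0 add0r mul1r => /eqP; rewrite -subr_eq subrr eq_sym => /eqP.
Qed.

Lemma linear_onD x y : S x -> S y -> l (x + y) = l x + l y.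
Proof. by move=> Sx Sy; rewrite -{1}[x]scale1r linl// mul1r. Qed.

Lemma linear_onZ a x : S x -> l (a *: x) = a * l x.
Proof.
by move=> Sx; have [S0 _] := subS; rewrite -[_ *: _]addr0 linl//
  linear_on0 addr0.
Qed.

Lemma linear_onB x y : S x -> S y -> l (x - y) = l x - l y.
Proof.
by move=> Sx Sy; rewrite -scaleN1r addrC linl// mulN1r addrC.
Qed.

Lemma linear_on_sum (I : finType) (F : I -> X) : (forall i, S (F i)) ->
  l (\sum_i F i) = \sum_i l (F i).
Proof.
move=> SF; suff [] : S (\sum_i F i) /\ l (\sum_i F i) = \sum_i l (F i) by [].
elim/big_rec2: _ => [|i a x _ [Sx lx]].
  by split; [case: subS|exact: linear_on0].
by split; [exact: linear_subspaceD|rewrite linear_onD// lx].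
Qed.

Lemma linear_on_comb r (e : 'I_r -> X) c : (forall i, S (e i)) ->
  l (comb e c) = \sum_i c ord0 i * l (e i).
Proof.
move=> Se; rewrite linear_on_sum; last by move=> i; exact: linear_subspaceZ.
by apply: eq_bigr => i _; rewrite linear_onZ.
Qed.

End linear_on.

Section semi_inner.
Context S g (subS : linear_subspace S) (gS : semi_inner S g).

Lemma semi_innerC x y : S x -> S y -> g x y = g y x.
Proof. by case: gS => + _ _; exact. Qed.

Lemma semi_inner_linl y : S y -> linear_on S (g^~ y).
Proof. by case: gS => _ + _; exact. Qed.

Lemma semi_inner_linr x : S x -> linear_on S (g x).
Proof.
move=> Sx a y z Sy Sz; have [_ SZ] := subS.
rewrite semi_innerC ?semi_inner_linl//; last exact: SZ.
by rewrite (semi_innerC Sy)// (semi_innerC Sz).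
Qed.

Lemma semi_inner_ge0 x : S x -> 0 <= g x x.
Proof. by case: gS => _ _; exact. Qed.

(** The equality case of Cauchy-Schwarz: otherwise a suitable multiple of x
    added to y would have a negative square. *)
Lemma semi_inner_null x y : S x -> S y -> g x x = 0 -> g x y = 0.
Proof.
move=> Sx Sy gxx; apply/eqP; apply/contraT => gxy.
(* the value of t for which the square of t x + y equals -1 *)
set t := - (g y y + 1) / (2 * g x y).
have [_ SZ] := subS.
have Sz : S (t *: x + y) by exact: SZ.
have := semi_inner_ge0 Sz.
rewrite (semi_inner_linl Sz)// !semi_inner_linr// gxx mulr0 add0r.
rewrite [g y x]semi_innerC//.
have -> : t * g x y + (t * g x y + g y y) = -1.
  by rewrite /t; field.
by rewrite oppr_ge0 leNgt ltr01.
Qed.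

End semi_inner.

Section orthonormal.
Context S g (subS : linear_subspace S) (gS : semi_inner S g).
Context r (e : 'I_r -> X) (eS : orthonormal_basis S g e).

Let Se i : S (e i). Proof. by case: eS. Qed.

Lemma basis_expansion l x : linear_on S l ->
  (forall z, S z -> g z z = 0 -> l z = 0) -> S x ->
  l x = \sum_i g x (e i) * l (e i).
Proof.
move=> linl lnull Sx; have [_ _ /(_ _ Sx)/= xnull] := eS.
have Sc := linear_subspace_comb (\row_i g x (e i)) subS Se.
have := lnull _ (linear_subspaceB subS Sx Sc) xnull.
rewrite (linear_onB linl)// => /eqP; rewrite subr_eq0 => /eqP ->.
rewrite (linear_on_comb _ linl)//.
by apply: eq_bigr => i _; rewrite mxE.
Qed.

Lemma inner_combE c x : S x -> g (comb e c) x = \sum_i c ord0 i * g (e i) x.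
Proof. by move=> Sx; rewrite (linear_on_comb _ (semi_inner_linl gS Sx)). Qed.

Lemma inner_comb_basis c i : g (comb e c) (e i) = c ord0 i.
Proof.
rewrite inner_combE// (bigD1 i)//= big1 ?addr0; last first.
  by move=> j ji; have [_ -> _] := eS; rewrite (negbTE ji) mulr0.
by have [_ -> _] := eS; rewrite eqxx mulr1.
Qed.

(** A linear form that kills the null vectors is represented by an actual
    vector, depending linearly on the form through its values on the basis. *)
Lemma riesz l x : linear_on S l -> (forall z, S z -> g z z = 0 -> l z = 0) ->
  S x -> g (comb e (\row_i l (e i))) x = l x.
Proof.
move=> linl lnull Sx; rewrite inner_combE// (basis_expansion linl lnull Sx).
apply: eq_bigr => i _; rewrite mxE mulrC; congr (_ * _).
exact: (semi_innerC gS).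
Qed.

End orthonormal.

(** Finite dimensionality modulo null vectors is expressed by a linear relation
    between vectors and coordinate sequences, since a piecewise polynomial
    need not determine its coefficients; vectors related to 0 must be null. *)
Definition represents S g (rep : X -> (nat -> R) -> Prop) : Prop :=
  (forall a x y c d, rep x c -> rep y d ->
     rep (a *: x + y) (fun i => a * c i + d i)) /\
  (forall x, S x -> rep x (fun=> 0) -> g x x = 0).

(** Gram-Schmidt, by induction on the number m of coordinates.  The vectors
    having coordinates whose last entry vanishes form a subspace S', and S is
    spanned by S' and a single vector x0; orthogonalising x0 against the basis
    of S' yields one more basis vector, or a null vector. *)
Lemma orthonormal_basis_exists S g rep m :
  linear_subspace S -> semi_inner S g -> represents S g rep ->
  (forall x, S x -> exists2 c, rep x c & forall i, (m <= i)%N -> c i = 0) ->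
  exists r (e : 'I_r -> X), orthonormal_basis S g e.
Proof.
move=> + + + ; elim: m S => [|m IH] S subS gS [repL rep0] repS.
  exists 0%N, (fun=> 0); split=> [[]//|[]//|x Sx /=].
  rewrite /comb big_ord0 subr0; apply: rep0 => //.
  have [c xc c0] := repS _ Sx.
  by suff -> : (fun=> 0) = c by []; apply/funext => i; rewrite c0.
pose S' := [set x | S x /\
  exists2 c, rep x c & forall i, (m <= i)%N -> c i = 0].
have S'S : S' `<=` S by move=> x [].
have subS' : linear_subspace S'.
  split; first split; first by case: subS.
    have [c xc c0] := repS _ subS.1.
    exists (fun i => -1 * c i + c i).
      by have := repL (-1) _ _ _ _ xc xc; rewrite scaler0 addr0.
    by move=> i _; rewrite mulN1r addNr.
  move=> a x y [Sx [c xc c0]] [Sy [d yd d0]]; split; first exact: subS.2.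
  exists (fun i => a * c i + d i); first exact: repL.
  by move=> i mi; rewrite c0// d0// mulr0 addr0.
have gS' : semi_inner S' g.
  have [g1 g2 g3] := gS; split.
  - by move=> x y /S'S ? /S'S ?; exact: g1.
  - by move=> y /S'S Sy a x z /S'S Sx /S'S Sz; exact: g2.
  - by move=> x /S'S; exact: g3.
have [] := IH S' subS' gS'.
- by split=> // x /S'S; exact: rep0.
- by move=> x [].
move=> r [e eS'].
have [S'e one e_null] := eS'.
have Se i : S (e i) by exact: S'S.
have [SS'|] := pselect (S `<=` S').
  by exists r, e; split => // x Sx; apply: e_null; exact: SS'.
move=> /existsNP[x0 /not_implyP[Sx0 S'x0]].
pose y := x0 - comb e (\row_i g x0 (e i)).
have Sc c : S (comb e c) by exact: linear_subspace_comb.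
have Sy : S y by exact: linear_subspaceB.
have [c0 x0c0 c00] := repS _ Sx0.
have c0m : c0 m != 0.
  apply/eqP => c0m; apply: S'x0; split => //; exists c0 => // i.
  by rewrite leq_eqVlt => /predU1P[<-//|]; exact: c00.
(* cancelling the last coordinate with a multiple of x0 *)
have SS'x0 x : S x -> exists a, S' (x - a *: x0).
  move=> Sx; have [c xc cm] := repS _ Sx.
  exists (c m / c0 m); split; first by apply: linear_subspaceB => //;
    exact: linear_subspaceZ.
  exists (fun i => - (c m / c0 m) * c0 i + c i).
    by rewrite -scaleNr addrC; exact: repL.
  move=> i; rewrite leq_eqVlt => /predU1P[<-|mi]; last first.
    by rewrite (c00 i)// (cm i)// mulr0 addr0.
  by rewrite mulNr divfK// addNr.
have SS'y x : S x -> exists a, S' (x - a *: y).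
  move=> Sx; have [a S'xa] := SS'x0 _ Sx; exists a.
  rewrite /y scalerBr opprB addrCA; apply: linear_subspaceD => //.
  by apply: linear_subspaceZ => //; exact: linear_subspace_comb.
have ye i : g y (e i) = 0.
  rewrite /y (linear_onB (semi_inner_linl gS (Se i)))//.
  by rewrite (inner_comb_basis subS' gS' eS') mxE subrr.
have ey i : g (e i) y = 0 by rewrite (semi_innerC gS).
have eproj x a : S x -> S' (x - a *: y) ->
    comb e (\row_i g x (e i)) = comb e (\row_i g (x - a *: y) (e i)).
  move=> Sx S'x; congr comb; apply/rowP => i; rewrite !mxE.
  rewrite (linear_onB (semi_inner_linl gS (Se i)))//;
    last exact: linear_subspaceZ.
  by rewrite (linear_onZ subS (semi_inner_linl gS (Se i)))// ye mulr0 subr0.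
have [gyy|gyy] := eqVneq (g y y) 0.
  exists r, e; split=> // x Sx /=; have [a S'x] := SS'y _ Sx.
  rewrite (eproj _ _ Sx S'x).
  set z := comb _ _; have := e_null _ S'x; rewrite -/z /=.
  set w := _ - z => gww.
  have Sw : S w by apply: linear_subspaceB;
    [|apply: linear_subspaceB|exact: Sc]; rewrite ?subS//;
    exact: linear_subspaceZ.
  have -> : x - z = a *: y + w by rewrite /w addrA addrCA subrr addr0.
  have Syw : S (a *: y + w) by exact: subS.2.
  rewrite (semi_inner_linl gS)// (semi_inner_null subS gS Sy)// mulr0 add0r.
  by rewrite (semi_inner_null subS gS Sw).
pose s := Num.sqrt (g y y); pose y1 := s^-1 *: y.
have gyy0 : 0 < g y y by rewrite lt_neqAle eq_sym gyy (semi_inner_ge0 gS).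
have gyyE : g y y = s ^+ 2 by rewrite sqr_sqrtr// ltW.
have sq0 : s != 0 by rewrite gt_eqF// sqrtr_gt0.
have Sy1 : S y1 by exact: linear_subspaceZ.
have gy1 : g y1 y1 = 1.
  rewrite /y1 (linear_onZ subS (semi_inner_linl gS Sy1))//.
  rewrite (linear_onZ subS (semi_inner_linr subS gS Sy))//.
  by rewrite gyyE; field.
have y1e i : g y1 (e i) = 0.
  by rewrite /y1 (linear_onZ subS (semi_inner_linl gS (Se i)))// ye mulr0.
have ey1 i : g (e i) y1 = 0 by rewrite (semi_innerC gS).
pose e1 (i : 'I_r.+1) := if unlift ord0 i is Some j then e j else y1.
exists r.+1, e1; split.
- by move=> i; rewrite /e1; case: unliftP.
- move=> i j; rewrite /e1.
  case: (unliftP ord0 i) => [i' ->|->]; case: (unliftP ord0 j) => [j' ->|->].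
  + by rewrite one (inj_eq (@lift_inj _ _)).
  + by rewrite (semi_innerC gS)// y1e.
  + by rewrite y1e.
  + by rewrite gy1 eqxx.
move=> x Sx /=; have [a S'x] := SS'y _ Sx.
have -> : comb e1 (\row_i g x (e1 i)) = a *: y + comb e (\row_i g (x - a *: y)
  (e i)).
  rewrite -eproj// /comb big_ord_recl; congr (_ + _).
    rewrite mxE /e1 unlift_none /y1 scalerA; congr (_ *: _).
    have -> : g x y1 = g (x - a *: y) y1 + a * g y y1.
      rewrite (linear_onB (semi_inner_linl gS Sy1))//;
        last exact: linear_subspaceZ.
      by rewrite (linear_onZ subS (semi_inner_linl gS Sy1))// subrK.
    have -> : g (x - a *: y) y1 = \sum_i g (x - a *: y) (e i) * g (e i) y1.
      apply: (@basis_expansion S' g subS' r e eS' (g^~ y1)) => //.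
      + by move=> b u v /S'S Su /S'S Sv; exact: (semi_inner_linl gS Sy1).
      + by move=> z /S'S Sz; exact: (semi_inner_null subS gS).
    rewrite big1 ?add0r; last by move=> i _; rewrite ey1 mulr0.
    rewrite /y1 (linear_onZ subS (semi_inner_linr subS gS Sy))//.
    by rewrite gyyE; field.
  by apply: eq_bigr => i _; rewrite !mxE /e1 liftK.
rewrite opprD addrA.
exact: (e_null _ S'x).
Qed.

End subspaces.

(** * Elimination of the flux and of the face unknowns *)

Section condensation.
Context (R : realType) (XV XW XM : lmodType R).
Context (SV : set XV) (SW : set XW) (SM : set XM).
Context (gV : XV -> XV -> R) (gW : XW -> XW -> R).
Context (B : XW * XM -> XV -> R) (s : XW * XM -> XW * XM -> R).
Context (rep : XM -> (nat -> R) -> Prop) (m : nat).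
Context (a b : nat) (v : 'I_a -> XV) (w : 'I_b -> XW).

Let SY : set (XW * XM) := [set y | SW y.1 /\ SM y.2].

Hypotheses (subV : linear_subspace SV) (subW : linear_subspace SW) (subM :
  linear_subspace SM).
Hypotheses (gVS : semi_inner SV gV) (gWS : semi_inner SW gW).
Hypotheses (vS : orthonormal_basis SV gV v) (wS : orthonormal_basis SW gW w).
Hypotheses (Bl : forall r, SV r -> linear_on SY (B^~ r))
           (Br : forall y, SY y -> linear_on SV (B y)).
Hypothesis Bnullr : forall y r, SY y -> SV r -> gV r r = 0 -> B y r = 0.
Hypothesis sS : semi_inner SY s.
Hypothesis Wnull : forall u, SW u -> gW u u = 0 ->
  s (u, 0) (u, 0) = 0 /\ forall r, SV r -> B (u, 0) r = 0.
Hypothesis repL : forall c x y d e, rep x d -> rep y e ->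
  rep (c *: x + y) (fun i => c * d i + e i).
Hypothesis rep_fin : forall x, SM x ->
  exists2 c, rep x c & forall i, (m <= i)%N -> c i = 0.
Hypothesis rep0 : forall mu, SM mu -> rep mu (fun=> 0) ->
  s (0, mu) (0, mu) = 0 /\ forall r, SV r -> B (0, mu) r = 0.

(** the flux determined by the scalar unknowns *)
Let Q y : XV := comb v (\row_i B y (v i)).

Let form y z : R := gV (Q y) (Q z) + s y z.

Let Sv i : SV (v i). Proof. by case: vS. Qed.
Let Sw i : SW (w i). Proof. by case: wS. Qed.

Let SVQ y : SV (Q y). Proof. exact: (linear_subspace_comb _ subV Sv). Qed.

Let Q_linear c y z : SY y -> SY z -> Q (c *: y + z) = c *: Q y + Q z.
Proof.
move=> Sy Sz; rewrite /Q -comb_linear; congr comb; apply/rowP => i.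
by rewrite !mxE (Bl (Sv i)).
Qed.

Let gVQ y r : SY y -> SV r -> gV (Q y) r = B y r.
Proof.
move=> Sy Sr; apply: (riesz subV gVS vS (Br Sy)) => //.
by move=> z Sz; exact: Bnullr.
Qed.

Let subY : linear_subspace SY.
Proof.
split; first by split; [case: subW|case: subM].
by move=> c [y1 y2] [z1 z2] [/= ? ?] [/= ? ?]; split=> /=;
  [apply: subW.2|apply: subM.2].
Qed.

Let form_semi_inner : semi_inner SY form.
Proof.
split.
- by move=> y z Sy Sz; rewrite /form (semi_innerC gVS)// (semi_innerC sS).
- move=> z Sz c x y Sx Sy; rewrite /form Q_linear//.
  by rewrite (semi_inner_linl gVS)// (semi_inner_linl sS)//; ring.
- by move=> y Sy; rewrite addr_ge0// ?(semi_inner_ge0 gVS)//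
    (semi_inner_ge0 sS).
Qed.

(** the pure face unknowns, onto which (u, 0) is projected *)
Let S0 : set (XW * XM) := [set y | y.1 = 0 /\ SM y.2].

Let S0Y : S0 `<=` SY.
Proof. by move=> [y1 y2] [/= -> ?]; split => //=; case: subW. Qed.

Let subS0 : linear_subspace S0.
Proof.
split; first by split=> //; case: subM.
move=> c [y1 y2] [z1 z2] [/= -> ?] [/= -> ?]; split=> /=.
  by rewrite scaler0 addr0.
exact: subM.2.
Qed.

Let form_S0 : semi_inner S0 form.
Proof.
have [f1 f2 f3] := form_semi_inner; split.
- by move=> x y /S0Y ? /S0Y ?; exact: f1.
- by move=> y /S0Y Sy c x z /S0Y Sx /S0Y Sz; exact: f2.
- by move=> x /S0Y; exact: f3.
Qed.

Let Q0 y : (forall r, SV r -> B y r = 0) -> Q y = 0.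
Proof.
move=> By0; rewrite /Q (_ : (\row_i _) = 0) ?comb0//.
by apply/rowP => i; rewrite !mxE By0.
Qed.

Let form_null y : SY y -> s y y = 0 -> (forall r, SV r -> B y r = 0) ->
  form y y = 0.
Proof.
move=> Sy sy By; rewrite /form sy Q0// addr0.
exact: (linear_on0 subV (semi_inner_linl gVS subV.1)).
Qed.

(** The completed basis vectors y i = (w i, uhat i) are orthogonal to all face
    unknowns for the condensed form, so that testing with (w', mu) does not
    see mu; the Gram matrix of the y i is the condensed operator. *)
Lemma condensation : exists2 L : 'M[R]_b, L^T = L /\
  (forall c : 'rV_b, 0 <= (c *m L *m c^T) ord0 ord0) &
  forall c : 'rV_b, exists q uhat, [/\ SV q, SM uhat &
    forall r w' mu, SV r -> SW w' -> SM mu ->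
      gV q r - B (comb w c, uhat) r + B (w', mu) q
      + s (comb w c, uhat) (w', mu) = gW (comb w (c *m L)) w'].
Proof.
have [||r0 [e eS]] := @orthonormal_basis_exists _ _ S0 form
  (fun y => rep y.2) m subS0 form_S0.
- split=> [c x y d d' /= ? ?|[y1 y2] [/= -> Sy2] ry]; first exact: repL.
  have [s0 B0] := rep0 Sy2 ry.
  by apply: form_null => //; split => //; case: subW.
- by move=> y [_ Sy]; exact: rep_fin.
have S0e i : S0 (e i) by case: eS.
have S0c c : S0 (comb e c) by exact: linear_subspace_comb.
have SM0 : SM 0 by case: subM.
have SW0 : SW 0 by case: subW.
have Sw0 i : SY (w i, 0) by split=> /=.
pose y i := (w i, 0) - comb e (\row_j form (w i, 0) (e j)).
have Sy i : SY (y i) by apply: linear_subspaceB => //; exact: S0Y.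
have y1 i : (y i).1 = w i by case: (S0c (\row_j form (w i, 0) (e j))) => /= ->;
  rewrite subr0.
have yorth i z : S0 z -> form (y i) z = 0.
  move=> S0z; have Sz := S0Y S0z.
  have -> : form (y i) z = \sum_j form z (e j) * form (y i) (e j).
    apply: (@basis_expansion _ _ S0 form subS0 _ e eS (form (y i))) => //.
    - move=> c u u' /S0Y Su /S0Y Su'.
      exact: (semi_inner_linr subY form_semi_inner).
    - move=> u /S0Y Su fu; rewrite (semi_innerC form_semi_inner)//.
      exact: (semi_inner_null subY form_semi_inner).
  rewrite big1// => j _.
  rewrite [X in _ * X](_ : _ = 0) ?mulr0// /y.
  rewrite (linear_onB (semi_inner_linl form_semi_inner (S0Y (S0e j))))//;
    last exact: S0Y.
  by rewrite (inner_comb_basis subS0 form_S0 eS) mxE subrr.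
have Syc c : SY (comb y c) by exact: linear_subspace_comb.
have ycorth c z : S0 z -> form (comb y c) z = 0.
  move=> S0z; have Sz := S0Y S0z.
  rewrite (linear_on_comb subY (semi_inner_linl form_semi_inner Sz))//.
  by rewrite big1// => i _; rewrite yorth// mulr0.
have yc1 c : (comb y c).1 = comb w c.
  rewrite /comb; elim/big_rec2: _ => [//|i x x' _ <-].
  by rewrite -(y1 i).
pose L := \matrix_(i, j) form (y i) (y j).
have cL c j : form (comb y c) (y j) = (c *m L) ord0 j.
  rewrite (linear_on_comb subY (semi_inner_linl form_semi_inner (Sy j)))//.
  by rewrite mxE; apply: eq_bigr => i _; rewrite mxE.
exists L; first split.
- by apply/matrixP => i j; rewrite !mxE (semi_innerC form_semi_inner).
- move=> c; rewrite (_ : _ ord0 ord0 = form (comb y c) (comb y c)).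
    exact: (semi_inner_ge0 form_semi_inner).
  rewrite (linear_on_comb subY (semi_inner_linr subY form_semi_inner (Syc
    c)))//.
  rewrite mxE; apply: eq_bigr => j _; rewrite cL mulrC; congr (_ * _).
  by rewrite mxE.
move=> c; exists (Q (comb y c)), (comb y c).2; split=> //;
  first by case: (Syc c).
move=> r w' mu Sr Sw' Smu.
rewrite -yc1 -surjective_pairing gVQ// subrr add0r.
have Swmu : SY (w', mu) by [].
rewrite -gVQ// (semi_innerC gVS)// -/(form _ _).
have -> : (w', mu) = 1 *: (w', 0) + (0, mu) by congr pair;
  rewrite /= ?scale1r ?scaler0 ?addr0 ?add0r.
rewrite (semi_inner_linr subY form_semi_inner)// mul1r (ycorth c (0, mu))//
  addr0.
have -> : form (comb y c) (w', 0) =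
    \sum_j gW w' (w j) * form (comb y c) (w j, 0).
  apply: (@basis_expansion _ _ SW gW subW _ w wS
    (fun u => form (comb y c) (u, 0))) => //.
  - move=> d u u' Su Su'.
    have -> : (d *: u + u', 0) = d *: (u, 0) + (u', 0) :> XW * XM.
      by apply: injective_projections; rewrite /= ?scaler0 ?addr0.
    by rewrite (semi_inner_linr subY form_semi_inner).
  - move=> u Su gu; have [s0 B0] := Wnull Su gu.
    have Su0 : SY (u, 0) by [].
    rewrite (semi_innerC form_semi_inner)//.
    by apply: (semi_inner_null subY form_semi_inner) => //; exact: form_null.
rewrite (inner_combE subW gWS wS)//; apply: eq_bigr => j _.
rewrite (semi_innerC gWS)// mulrC; congr (_ * _); rewrite -cL.
have -> : (w j, 0) = 1 *: y j + comb e (\row_k form (w j, 0) (e k)).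
  by rewrite scale1r /y subrK.
rewrite (semi_inner_linr subY form_semi_inner)//; last exact: S0Y.
by rewrite mul1r (ycorth c (comb e _))// addr0.
Qed.

End condensation.

(** * Polynomial functions *)

Section polyfun.
Context (R : realType).

(** Continuity, measurability, boundedness and differentiability all follow by
    induction on the construction of a polynomial function. *)
Inductive polyfun n : ('rV[R]_n -> R) -> Prop :=
| polyfun_cst c : polyfun (fun=> c)
| polyfun_coord i : polyfun (fun x => x ord0 i)
| polyfunD f g : polyfun f -> polyfun g -> polyfun (fun x => f x + g x)
| polyfunM f g : polyfun f -> polyfun g -> polyfun (fun x => f x * g x).

Lemma polyfun_sum n (I : Type) (r : seq I) (P : pred I) (F : I -> 'rV[R]_n ->
  R) :
  (forall i, polyfun (F i)) -> polyfun (fun x => \sum_(i <- r | P i) F i x).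
Proof.
move=> PF; elim: r => [|i r IH].
  by rewrite (_ : (fun _ => _) = (fun=> 0));
    [exact: polyfun_cst|apply/funext => x; rewrite big_nil].
have [Pi|Pi] := boolP (P i).
  rewrite (_ : (fun _ => _) = fun x => F i x + \sum_(i <- r | P i) F i x).
    exact: polyfunD.
  by apply/funext => x; rewrite big_cons Pi.
rewrite (_ : (fun _ => _) = fun x => \sum_(i <- r | P i) F i x) //.
by apply/funext => x; rewrite big_cons (negbTE Pi).
Qed.

Lemma polyfun_prod n (I : Type) (r : seq I) (P : pred I) (F : I -> 'rV[R]_n ->
  R) :
  (forall i, polyfun (F i)) -> polyfun (fun x => \prod_(i <- r | P i) F i x).
Proof.
move=> PF; elim: r => [|i r IH].
  by rewrite (_ : (fun _ => _) = (fun=> 1));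
    [exact: polyfun_cst|apply/funext => x; rewrite big_nil].
have [Pi|Pi] := boolP (P i).
  rewrite (_ : (fun _ => _) = fun x => F i x * \prod_(i <- r | P i) F i x).
    exact: polyfunM.
  by apply/funext => x; rewrite big_cons Pi.
rewrite (_ : (fun _ => _) = fun x => \prod_(i <- r | P i) F i x) //.
by apply/funext => x; rewrite big_cons (negbTE Pi).
Qed.

Lemma polyfunX n (f : 'rV[R]_n -> R) k : polyfun f -> polyfun (fun x => f x ^+
  k).
Proof.
move=> pf; elim: k => [|k IH].
  by rewrite (_ : (fun _ => _) = (fun=> 1));
    [exact: polyfun_cst|apply/funext => x; rewrite expr0].
rewrite (_ : (fun _ => _) = fun x => f x * f x ^+ k); first exact: polyfunM.
by apply/funext => x; rewrite exprS.
Qed.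

Lemma polyfun_comp n m (f : 'rV[R]_n -> R) (A : 'rV[R]_m -> 'rV[R]_n) :
  polyfun f -> (forall i, polyfun (fun x => A x ord0 i)) -> polyfun (f \o A).
Proof.
move=> pf pA; elim: pf => [c|i|g h _ pg _ ph|g h _ pg _ ph].
- exact: polyfun_cst.
- exact: pA.
- exact: polyfunD.
- exact: polyfunM.
Qed.

Lemma polyfun_linear n m (B : 'M[R]_(m, n)) i :
  polyfun (fun x : 'rV[R]_m => (x *m B) ord0 i).
Proof.
rewrite (_ : (fun _ => _) = fun x : 'rV[R]_m => \sum_j x ord0 j * B j i).
  by apply: polyfun_sum => j; apply: polyfunM;
    [exact: polyfun_coord|exact: polyfun_cst].
by apply/funext => x; rewrite mxE.
Qed.

Lemma polyfun_continuous n (f : 'rV[R]_n -> R) : polyfun f -> continuous f.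
Proof.
elim=> [c|i|g h _ cg _ ch|g h _ cg _ ch] x.
- exact: cst_continuous.
- exact: coord_continuous.
- exact: (cvgD (cg x) (ch x)).
- exact: (cvgM (cg x) (ch x)).
Qed.

Lemma open_polyfun_gt n (f : 'rV[R]_n -> R) c : polyfun f -> open [set x | c <
  f x].
Proof.
move=> pf; apply: (@open_comp _ _ f [set y | c < y]); last exact: open_gt.
by move=> x _; exact: polyfun_continuous.
Qed.

Lemma open_forall (X : topologicalType) (I : finType) (A : I -> set X) :
  (forall i, open (A i)) -> open [set x | forall i, A i x].
Proof.
move=> oA; rewrite openE => x Ax.
apply: (@filter_forall _ _ A (nbhs x) (nbhs_filter _)) => i.
exact: open_nbhs_nbhs.
Qed.

Lemma polyfun_measurable n (f : 'rV[R]_n -> R) D : polyfun f -> measurable_fun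
  D f.
Proof.
move=> pf; apply: (@measurable_funS _ _ _ _ setT) => //.
elim: pf => [c|i|g h _ cg _ ch|g h _ cg _ ch].
- exact: measurable_cst.
- exact: measurable_rV_coord.
- exact: measurable_funD.
- exact: measurable_funM.
Qed.

Lemma polyfun_bounded n (f : 'rV[R]_n -> R) M : polyfun f ->
  exists C, forall x : 'rV[R]_n, (forall i, `|x ord0 i| <= M) -> `|f x| <= C.
Proof.
elim=> [c|i|g h _ [C CP] _ [D DP]|g h _ [C CP] _ [D DP]].
- by exists `|c|.
- by exists M.
- exists (C + D) => x xM; rewrite (le_trans (ler_normD _ _))//.
  by rewrite lerD ?CP ?DP.
- exists (C * D) => x xM; rewrite normrM.
  by rewrite ler_pM ?CP ?DP.
Qed.

Lemma coord_quotient n i (v x : 'rV[R]_n) :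
  (fun h : R => h^-1 *: ((h *: v + x) ord0 i - x ord0 i)) @ 0^' --> v ord0 i.
Proof.
apply: cvg_near_cst; near=> t.
have t0 : t != 0 by near: t; exact: nbhs_dnbhs_neq.
by rewrite !mxE addrK scalerA mulVf// scale1r.
Unshelve. all: by end_near. Qed.

(** The derivative is again polynomial, which makes the divergence of a
    discrete flux square integrable on each cell. *)
Lemma polyfun_derive n (f : 'rV[R]_n -> R) v : polyfun f ->
  exists2 g, polyfun g & forall x, is_derive x v f (g x).
Proof.
elim=> [c|i|g h pg [g' pg' dg] ph [h' ph' dh]|g h pg [g' pg' dg] ph [h' ph'
  dh]].
- exists (fun=> 0); first exact: polyfun_cst.
  by move=> x; exact: is_derive_cst.
- exists (fun=> v ord0 i); first exact: polyfun_cst.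
  move=> x; apply: DeriveDef.
    apply: cvgP; exact: coord_quotient.
  apply: cvg_lim => //; exact: coord_quotient.
- exists (fun x => g' x + h' x); first exact: polyfunD.
  by move=> x; exact: is_deriveD.
- exists (fun x => g x * h' x + h x * g' x).
    by apply: polyfunD; exact: polyfunM.
  move=> x; have := is_deriveM (dg x) (dh x).
  by [].
Qed.

Lemma polyfun_meval n (p : mpoly.mpoly n R) :
  polyfun (fun x => mpoly.meval (fun i => x ord0 i) p).
Proof.
rewrite (_ : (fun _ => _) = fun x : 'rV[R]_n => \sum_(m <- mpoly.msupp p)
  mpoly.mcoeff m p * \prod_(i < n) x ord0 i ^+ (m : mpoly.multinom n) i);
    last first.
  by apply/funext => x; rewrite mpoly.mevalE.
apply: polyfun_sum => m; apply: polyfunM; first exact: polyfun_cst.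
by apply: polyfun_prod => i; apply: polyfunX; exact: polyfun_coord.
Qed.

End polyfun.

(** * Minimisation of a coercive polynomial energy *)

Section dotp_theory.
Context (R : realType).
Implicit Types (n : nat).

Lemma dotpE n (x y : 'rV[R]_n) : dotp x y = (x *m y^T) ord0 ord0.
Proof. by rewrite mxE; apply: eq_bigr => i _; rewrite mxE. Qed.

Lemma dotpC n (x y : 'rV[R]_n) : dotp x y = dotp y x.
Proof. by apply: eq_bigr => i _; rewrite mulrC. Qed.

Lemma dotpDl n (x y z : 'rV[R]_n) : dotp (x + y) z = dotp x z + dotp y z.
Proof. by rewrite !dotpE mulmxDl mxE. Qed.

Lemma dotpZl n a (x z : 'rV[R]_n) : dotp (a *: x) z = a * dotp x z.
Proof. by rewrite !dotpE -scalemxAl mxE. Qed.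

Lemma dotpBl n (x y z : 'rV[R]_n) : dotp (x - y) z = dotp x z - dotp y z.
Proof. by rewrite dotpDl -scaleN1r dotpZl mulN1r. Qed.

Lemma dotpDr n (x y z : 'rV[R]_n) : dotp x (y + z) = dotp x y + dotp x z.
Proof. by rewrite dotpC dotpDl !(dotpC x). Qed.

Lemma dotpZr n a (x z : 'rV[R]_n) : dotp x (a *: z) = a * dotp x z.
Proof. by rewrite dotpC dotpZl (dotpC x). Qed.

Lemma dotp_mulmxr n m (x : 'rV[R]_n) (y : 'rV[R]_m) B :
  dotp x (y *m B) = dotp (x *m B^T) y.
Proof. by rewrite !dotpE trmx_mul mulmxA. Qed.

Lemma sqr_coord_le_dotp n (x : 'rV[R]_n) i : x ord0 i ^+ 2 <= dotp x x.
Proof.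
rewrite /dotp (bigD1 i)//= -expr2 lerDl sumr_ge0// => j _.
by rewrite -expr2 sqr_ge0.
Qed.

Lemma dotp_eq0 n (x : 'rV[R]_n) : (forall y, dotp x y = 0) -> x = 0.
Proof.
move=> x0; apply/rowP => i; rewrite mxE; apply/eqP.
rewrite -sqrf_eq0 eq_le sqr_ge0 andbT.
by rewrite (le_trans (sqr_coord_le_dotp _ _))// x0.
Qed.

End dotp_theory.

(** Near 0 the linear term dominates, so it must vanish; this replaces
    differentiation of the energy at its minimum. *)
Lemma quartic_nonneg_slope (R : realFieldType) (a1 a2 a3 a4 : R) :
  (forall t, 0 <= t * a1 + t ^+ 2 * a2 + t ^+ 3 * a3 + t ^+ 4 * a4) -> a1 = 0.
Proof.
move=> nonneg; apply/eqP/contraT => a10.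
(* t is opposite to the slope and small against the other coefficients *)
pose M := `|a1| + `|a2| + `|a3| + `|a4| + 1.
have M0 : 0 < M by rewrite ltr_wpDl// !addr_ge0.
pose t := - a1 / M.
have t1 : `|t| <= 1.
  by rewrite normrM normrN normfV (gtr0_norm M0) ler_pdivrMr//
    mul1r /M -!addrA lerDl !addr_ge0.
have t0 : 0 < t ^+ 2 by rewrite exprn_even_gt0//= mulf_neq0// ?oppr_eq0//
  invr_eq0 gt_eqF.
have := nonneg t.
have -> : t * a1 = - (t ^+ 2 * M) by rewrite /t; field; rewrite gt_eqF.
rewrite !exprS expr0 mulr1 in t0 *.
have -> : - (t * t * M) + t * t * a2 + t * (t * t) * a3 + t * (t * (t * t)) * a4
  = t * t * (a2 + t * a3 + t * t * a4 - M) by ring.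
rewrite pmulr_rge0// subr_ge0 leNgt => /negP[].
have tt1 : `|t * t| <= 1 by rewrite normrM mulr_ile1.
have : t * a3 <= `|a3|.
  by rewrite (le_trans (ler_norm _))// normrM ler_piMl.
have : t * t * a4 <= `|a4|.
  by rewrite (le_trans (ler_norm _))// normrM ler_piMl.
have := ler_norm a2; have := normr_ge0 a1; rewrite /M; lra.
Qed.

(** The sublevel set of f 0 lies in a compact cube. *)
Lemma coercive_polyfun_min (R : realType) n (f : 'rV[R]_n -> R) M : polyfun f ->
  (forall x, f x <= f 0 -> forall i, `|x ord0 i| <= M) ->
  exists x, forall y, f x <= f y.
Proof.
move=> pf coer.
pose K := [set x : 'rV[R]_n | forall i, `[- M, M]%classic (x ord0 i)].
have cK : compact K by apply: (@rV_compact _ _ (fun=> `[- M, M]%classic)) => i;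
  exact: segment_compact.
have K0 : K 0.
  move=> i; rewrite /= in_itv/= mxE oppr_le0 andbb.
  by have := coer 0 (lexx _) i; rewrite mxE normr0.
have [|| x /set_mem Kx xmin] := @EVT_min_rV R n f K _ cK.
- by exists 0.
- by apply: continuous_subspaceT; exact: polyfun_continuous.
exists x => y; have [yx|/ltW//] := leP (f y) (f x).
apply: (xmin _); apply/mem_set => i; rewrite /= in_itv/= -ler_norml.
apply: coer; rewrite (le_trans yx)//; apply: (xmin _); exact/mem_set.
Qed.

Section implicit_gradient_step.
Context (R : realType) (b : nat) (L : 'M[R]_b).
Hypotheses (Lsym : L^T = L) (Lpos : forall x, 0 <= dotp (x *m L) x).
Context (Phi : 'rV[R]_b -> R) (F : 'rV[R]_b -> 'rV[R]_b) (alpha C : R).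
Hypothesis PhiP : polyfun Phi.
Hypothesis Phi_coercive : forall x, alpha * dotp x x - C <= Phi x.
Hypothesis alpha0 : 0 < alpha.
Hypothesis Phi_deriv : forall x y, exists a2 a3 a4, forall t,
  Phi (x + t *: y) =
  Phi x + t * dotp (F x) y + t ^+ 2 * a2 + t ^+ 3 * a3 + t ^+ 4 * a4.

(** The unknown psi of the minimisation problem matters only through psi L, so
    the problem is degenerate along the kernel of L.  It is therefore
    parametrised by the coordinates eta of psi L in a basis B of the row space
    of L; these coordinates are bounded when u is. *)
Lemma implicit_gradient_step dt eps up : 0 < dt -> 0 < eps ->
  exists u phi, u - up + dt *: (phi *m L) = 0 /\
    phi = eps^-1 *: F u + eps *: (u *m L).
Proof.
move=> dt0 eps0.
pose B := row_base L; pose P := B *m pinvmx L.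
have PL : P *m L = B by rewrite mulmxKpV// eq_row_base.
have [B' BB'] : exists B', B *m B' = 1%:M by apply/row_freeP;
  exact: row_base_free.
pose psi (eta : 'rV[R]_(\rank L)) := eta *m P.
pose u (eta : 'rV[R]_(\rank L)) := up - dt *: (eta *m B).
pose J eta := dt / 2 * dotp (psi eta *m L) (psi eta)
  + eps / 2 * dotp (u eta *m L) (u eta) + eps^-1 * Phi (u eta).
have pu i : polyfun (fun eta => u eta ord0 i).
  rewrite (_ : (fun _ => _) = fun eta => up ord0 i + - dt * (eta *m B) ord0 i).
    apply: polyfunD; [exact: polyfun_cst|apply: polyfunM;
      [exact: polyfun_cst|]].
    exact: polyfun_linear.
  by apply/funext => eta; rewrite !mxE mulNr.
have pquad m (A : 'rV[R]_(\rank L) -> 'rV[R]_m) (D : 'M[R]_m) :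
    (forall i, polyfun (fun x => A x ord0 i)) -> polyfun (fun x => dotp (A x *m
      D) (A x)).
  move=> pA; apply: polyfun_sum => i; apply: polyfunM => //.
  exact: (polyfun_comp (polyfun_linear D i) pA).
have pJ : polyfun J.
  apply: polyfunD; first apply: polyfunD.
  - apply: polyfunM; first exact: polyfun_cst.
    by apply: pquad => i; exact: polyfun_linear.
  - by apply: polyfunM; [exact: polyfun_cst|exact: pquad].
  - by apply: polyfunM; [exact: polyfun_cst|exact: polyfun_comp].
(* the quadratic terms of J are nonnegative, so J bounds u through Phi alone *)
pose N := (eps * J 0 + C) / alpha.
have uN eta : J eta <= J 0 -> dotp (u eta) (u eta) <= N.
  move=> Jeta; rewrite /N ler_pdivlMr// -lerBlDr mulrC.
  apply: (le_trans (Phi_coercive _)); rewrite -ler_pdivrMl//.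
  apply: le_trans Jeta; rewrite lerDr addr_ge0// mulr_ge0// divr_ge0// ltW//.
have [M JM] : exists M, forall eta, J eta <= J 0 -> forall i, `|eta ord0 i| <=
  M.
  exists (dt^-1 * (\sum_i \sum_j (`|up ord0 i| + (1 + N)) * `|B' i j|)) => eta
    Jeta j.
  have -> : eta = dt^-1 *: ((up - u eta) *m B').
    by rewrite /u opprB addrC subrK -scalemxAl -mulmxA BB' mulmx1 scalerA mulVf
      ?scale1r// gt_eqF.
  rewrite mxE normrM gtr0_norm ?invr_gt0// ler_pM2l ?invr_gt0// mxE.
  rewrite (le_trans (ler_norm_sum _ _ _))// ler_sum// => i _.
  have Nu : `|u eta ord0 i| <= 1 + N.
    have := le_trans (sqr_coord_le_dotp (u eta) i) (uN _ Jeta).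
    have := normr_ge0 (u eta ord0 i).
    rewrite -[u eta ord0 i ^+ 2]real_normK ?num_real//.
    set z := `|u eta ord0 i|; nra.
  rewrite (bigD1 j)//= normrM ler_wpDr//.
    by rewrite sumr_ge0// => l _; rewrite mulr_ge0// addr_ge0// (le_trans _ Nu).
  rewrite ler_wpM2r//; rewrite !mxE (le_trans (ler_normB _ _))// lerD2l.
  by move: Nu; rewrite !mxE.
have [eta Jmin] := coercive_polyfun_min pJ JM.
pose phi := eps^-1 *: F (u eta) + eps *: (u eta *m L).
have qexp m (D : 'M[R]_m) (x y : 'rV_m) t : D^T = D ->
    dotp ((x + t *: y) *m D) (x + t *: y) =
    dotp (x *m D) x + t * (2 * dotp (x *m D) y) + t ^+ 2 * dotp (y *m D) y.
  move=> Dsym; rewrite mulmxDl -scalemxAl !dotpDl !dotpDr !dotpZl !dotpZr.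
  rewrite (_ : dotp (y *m D) x = dotp (x *m D) y); first by ring.
  by rewrite dotpC dotp_mulmxr Dsym.
(* stationarity in the direction delta, as a slope that must vanish *)
have orth : (psi eta - phi) *m B^T = 0.
  apply: dotp_eq0 => delta; rewrite -dotp_mulmxr.
  have [a2 [a3 [a4 PhiE]]] := Phi_deriv (u eta) (- dt *: (delta *m B)).
  pose v := - dt *: (delta *m B).
  have ut t : u (eta + t *: delta) = u eta + t *: v.
    rewrite /u /v mulmxDl -scalemxAl scalerDr opprD addrA; congr (_ + _).
    by rewrite !scalerA -scaleNr mulrN mulrC.
  have psit t : psi (eta + t *: delta) = psi eta + t *: psi delta.
    by rewrite /psi mulmxDl -scalemxAl.
  have := @quartic_nonneg_slope R
    (dt * dotp (psi eta *m L) (psi delta) + dotp phi v)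
    (dt / 2 * dotp (psi delta *m L) (psi delta)
      + eps / 2 * dotp (v *m L) v + eps^-1 * a2) (eps^-1 * a3) (eps^-1 * a4).
  have phiv : dotp phi v = eps * dotp (u eta *m L) v + eps^-1 * dotp (F (u
    eta)) v.
    by rewrite /phi dotpDl !dotpZl addrC.
  move=> slope0.
  have : dt * dotp (psi eta *m L) (psi delta) + dotp phi v = 0.
    apply: slope0 => t; have := Jmin (eta + t *: delta); rewrite -subr_ge0.
    congr (0 <= _); rewrite /J ut psit PhiE !qexp// phiv.
    by field; rewrite gt_eqF.
  have Lr x y : dotp (x *m L) y = dotp x (y *m L) by rewrite dotp_mulmxr Lsym.
  rewrite Lr dotpZr {2}/psi -mulmxA PL.
  rewrite mulNr -mulrBr => /eqP; rewrite mulf_eq0 gt_eqF//= => /eqP.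
  by rewrite dotpBl.
exists (u eta), phi; split=> //.
(* orthogonality to the row space of L, which is also its column space *)
have LE : L = B^T *m (col_base L)^T by rewrite -trmx_mul mulmx_base Lsym.
have /(congr1 (fun z => z *m (col_base L)^T)) := orth.
rewrite mul0mx -mulmxA -LE mulmxBl => /eqP; rewrite subr_eq0 => /eqP <-.
by rewrite /psi -mulmxA PL /u [up - _]addrC addrK addNr.
Qed.

End implicit_gradient_step.

(** * Lebesgue measure and square integrable functions *)

Section boxes.
Context (R : realType).

Definition box n (c : 'rV[R]_n) (e : R) : set 'rV[R]_n :=
  [set x | forall i, `|x ord0 i - c ord0 i| <= e].

Lemma nbhs_box n (x : 'rV[R]_n) (A : set 'rV[R]_n) :
  nbhs x A -> exists2 e, 0 < e & box x e `<=` A.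
Proof.
move=> /nbhs_ballP[e /= e0 eA]; exists (e / 2); first by rewrite divr_gt0.
move=> y xy; apply: eA; split=> // i j; rewrite (ord1 i).
rewrite /ball/= distrC (le_lt_trans (xy j))// ltr_pdivrMr// ltr_pMr//.
by rewrite ltr1n.
Qed.

Lemma measurable_box n (c : 'rV[R]_n) e : measurable (box c e).
Proof.
rewrite (_ : box c e = \big[setI/setT]_(i < n)
    ((fun x : 'rV[R]_n => x ord0 i : measurableTypeR R) @^-1`
      [set` `[c ord0 i - e, c ord0 i + e]])).
  apply: bigsetI_measurable => i _; rewrite -[X in measurable X]setTI.
  exact: measurable_rV_coord.
rewrite -bigcap_seq; apply/seteqP; split => x /=.
  by move=> xc i _ /=; rewrite in_itv/= -ler_distl.
move=> xc i; have := xc i; rewrite /= in_itv/= -ler_distl; apply.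
exact: mem_index_enum.
Qed.

(** By induction on the dimension: a cube is the product of an interval with a
    cube, and the measure is a product measure. *)
Lemma rV_lebesgue_box n (c : 'rV[R]_n) e : 0 < e ->
  rV_lebesgue R n (box c e) = ((e *+ 2) ^+ n)%:E.
Proof.
move=> e0; elim: n c => [|n IH] c.
  rewrite /= /dirac indicE mem_set ?expr0// => -[]//.
rewrite [LHS]/= /rV_lebesgue_step /pushforward.
have -> : (@rV_cons R n) @^-1` box c e =
    [set` `[c ord0 ord0 - e, c ord0 ord0 + e]] `*` box (rV_uncons c).2 e.
  apply/seteqP; split => -[a y] /=.
    move=> H; split.
      by have := H ord0; rewrite mxE unlift_none in_itv/= -ler_distl.
    by move=> i; have := H (lift ord0 i); rewrite !mxE liftK.
  move=> [H1 H2] i; rewrite mxE; case: unliftP => [j ->|->].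
    by have := H2 j; rewrite mxE.
  by move: H1; rewrite in_itv/= -ler_distl.
rewrite product_measure1E//; last exact: measurable_box.
rewrite IH exprS EFinM; congr (_ * _)%E.
transitivity (lebesgue_measure
  [set` `[c ord0 ord0 - e, c ord0 ord0 + e]] : \bar R) => //.
rewrite lebesgue_measure_itv/= lte_fin ltrD2l gtrN// -EFinD.
by congr EFin; rewrite mulr2n; ring.
Qed.

(** An open set is the union of the countably many cubes with rational centre
    and radius 1/(j+1) that it contains. *)
Lemma open_measurable_rV n (A : set 'rV[R]_n) : open A -> measurable A.
Proof.
move=> oA.
pose B (p : 'rV[rat]_n * nat) := box (map_mx ratr p.1) (p.2.+1%:R^-1 : R).
have -> : A = \bigcup_k (if unpickle k is Some p then
    if `[< B p `<=` A >] then B p else set0 else set0).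
  apply/seteqP; split => x.
    move=> Ax; have /nbhs_box[e e0 eA] : nbhs x A by exact: open_nbhs_nbhs.
    have e20 : 0 < e / 2 by rewrite divr_gt0.
    have [k _ /(_ k (leqnn _)) /= ke] := near_infty_natSinv_lt (PosNum e20).
    have qP i : exists q : rat, `|x ord0 i - ratr q| <= k.+1%:R^-1.
      have : x ord0 i - k.+1%:R^-1 < x ord0 i + k.+1%:R^-1.
        by rewrite ltrD2l gtrN// invr_gt0.
      move=> /rat_in_itvoo[q]; rewrite in_itv/= => /andP[q1 q2]; exists q.
      by rewrite distrC ler_distl !ltW.
    pose p := (\row_i projT1 (cid (qP i)), k) : 'rV[rat]_n * nat.
    have Bpx : B p x by move=> i; rewrite !mxE; case: cid.
    exists (pickle p) => //; rewrite pickleK ifT//.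
    apply/asboolP => y By; apply: eA => i.
    apply: (le_trans (ler_distD (map_mx ratr p.1 ord0 i) _ _)).
    rewrite [leRHS]splitr lerD//; first exact: le_trans (By i) (ltW ke).
    by rewrite distrC; exact: le_trans (Bpx i) (ltW ke).
  move=> [k _]; case: unpickle => // p; case: asboolP => // pA; exact: pA.
apply: bigcupT_measurable => k; case: unpickle => // p.
by case: asboolP => // _; exact: measurable_box.
Qed.

End boxes.

Section square_integrable.
Context (R : realType) (n : nat).
Implicit Types (D : set 'rV[R]_n) (f g : 'rV[R]_n -> R).
Local Notation mu := (rV_lebesgue R n).

Definition L2_inner D f g : R := \int[mu]_(x in D) (f x * g x).

Lemma square_integrableM D f g : measurable D ->
  square_integrable D f -> square_integrable D g ->
  mu.-integrable D (EFin \o (fun x => f x * g x)).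
Proof.
move=> mD [mf if2] [mg ig2].
apply: (le_integrable mD _ _ (integrableD mD if2 ig2)).
  by apply/measurable_EFinP; exact: measurable_funM.
move=> x _ /=; rewrite lee_fin.
rewrite (ger0_norm (addr_ge0 (sqr_ge0 _) (sqr_ge0 _))) ler_norml.
by apply/andP; split; nra.
Qed.

Lemma square_integrable_subspace D : measurable D ->
  linear_subspace (square_integrable D).
Proof.
move=> mD; split.
  split; first exact: measurable_cst.
  rewrite (_ : (fun _ => _) = cst 0%E); first exact: integrable0.
  by apply/funext => x; rewrite expr0n.
move=> a f g sf sg; have [mf if2] := sf; have [mg ig2] := sg; split.
  by apply: measurable_funD => //; apply: measurable_funM.
have -> : (fun x => (((a *: f + g) x) ^+ 2)%:E) =
    ((fun x => (a ^+ 2)%:E * (f x ^+ 2)%:E) \+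
     ((fun x => (a *+ 2)%:E * (EFin \o (fun x => f x * g x)%R) x) \+
      (fun x => (g x ^+ 2)%:E)))%E.
  apply/funext => x /=; rewrite -!EFinM -!EFinD; congr EFin.
  have E (u v : R) : (a * u + v) ^+ 2 =
    a ^+ 2 * u ^+ 2 + (a *+ 2 * (u * v) + v ^+ 2) by ring.
  exact: E.
apply: integrableD => //; first exact: integrableZl.
by apply: integrableD => //; apply: integrableZl => //;
  exact: square_integrableM.
Qed.

Lemma square_integrableS D D' f : measurable D -> measurable D' -> D' `<=` D ->
  square_integrable D f -> square_integrable D' f.
Proof.
move=> mD mD' DD' [mf if2]; split; first exact: measurable_funS mf.
exact: integrableS if2.
Qed.

Lemma eq_square_integrable D f g : {in D, f =1 g} ->
  square_integrable D f -> square_integrable D g.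
Proof.
move=> fg [mf if2]; split; first exact: eq_measurable_fun mf.
have fg2 : {in D, (fun x => (f x ^+ 2)%:E) =1 (fun x => (g x ^+ 2)%:E)}.
  by move=> x Dx; rewrite fg.
move: if2 => /integrableP[mf2 if2]; apply/integrableP; split.
  exact: eq_measurable_fun mf2.
rewrite (_ : integral _ _ _ = \int[mu]_(x in D) `|(f x ^+ 2)%:E|)%E//.
by apply: eq_integral => x Dx; rewrite fg.
Qed.

Lemma polyfun_square_integrable D f c e : measurable D -> 0 < e ->
  D `<=` box c e -> polyfun f -> square_integrable D f.
Proof.
move=> mD e0 De pf; split; first exact: polyfun_measurable.
apply: measurable_bounded_integrable => //.
- rewrite (@le_lt_trans _ _ (mu (box c e)))//.
    by apply: le_measure => //; rewrite inE//; exact: measurable_box.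
  by rewrite rV_lebesgue_box// ltry.
- by apply: measurable_funX; exact: polyfun_measurable.
have [C CP] := polyfun_bounded (\sum_i (`|c ord0 i| + e)) (polyfunX 2 pf).
exists C; split; first exact: num_real.
move=> y Cy x Dx /=; apply: (le_trans _ (ltW Cy)); apply: CP => i.
have := De _ Dx i.
rewrite (bigD1 i)//= => xc; apply: ler_wpDr.
  by rewrite sumr_ge0// => j _; rewrite addr_ge0// ltW.
rewrite -[x ord0 i](subrK (c ord0 i)) (le_trans (ler_normD _ _))// addrC.
by rewrite lerD2l.
Qed.

Lemma L2_semi_inner D : measurable D -> semi_inner (square_integrable D)
  (L2_inner D).
Proof.
move=> mD; split.
- by move=> f g _ _; apply: eq_Rintegral => x _; rewrite mulrC.
- move=> g sg a f h sf sh; rewrite /L2_inner.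
  rewrite -RintegralZl//; last exact: square_integrableM.
  rewrite -RintegralD//; last 2 first.
  + have -> : EFin \o (fun x => a * (f x * g x)) =
        (fun x => a%:E * (EFin \o (fun x => f x * g x)%R) x)%E by [].
    by apply: integrableZl => //; exact: square_integrableM.
  + exact: square_integrableM.
  apply: eq_Rintegral => x _.
  have E (u v w : R) : (a * u + v) * w = a * (u * w) + v * w by ring.
  exact: E.
- by move=> f _; apply: Rintegral_ge0 => x _; rewrite -expr2 sqr_ge0.
Qed.

(** If f were nonzero at a point, its square would be bounded below by a
  positive
    constant on a cube around that point, and cubes have positive measure. *)
Lemma L2_polyfun_eq0 D f g : open D -> square_integrable D f -> polyfun g ->
  {in D, f =1 g} -> L2_inner D f f = 0 -> {in D, forall x, f x = 0}.
Proof.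
move=> oD sf pg fg lf0 x0 /[dup] Dx0 /set_mem Dx0'; rewrite fg//.
have mD := open_measurable_rV oD.
apply/eqP/contraT => gx0.
pose d := g x0 ^+ 2 / 2.
have gx0p : 0 < g x0 ^+ 2 by rewrite exprn_even_gt0.
have d0 : 0 < d by rewrite divr_gt0.
have : nbhs x0 (D `&` [set x | d < g x ^+ 2]).
  apply: filterI; first exact: open_nbhs_nbhs.
  have cg2 := polyfun_continuous (polyfunX 2 pg).
  have := cg2 x0; move=> /cvgr_gt; apply.
  by rewrite /d ltr_pdivrMr// ltr_pMr// ltr1n.
move=> /nbhs_box[e e0 eB].
have [mf if2] := sf.
have : (\int[mu]_(x in box x0 e) (cst d%:E x) <= \int[mu]_(x in D) (f x ^+
  2)%:E)%E.
  apply: (@le_trans _ _ (\int[mu]_(x in box x0 e) (f x ^+ 2)%:E)%E).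
    apply: ge0_le_integral => //.
    - exact: measurable_box.
    - by move=> x _; rewrite /= lee_fin ltW.
    - apply/measurable_EFinP; apply: measurable_funX.
      by apply: measurable_funS mf => // x /eB[].
    - move=> x /eB[Dx /= dx]; rewrite /= lee_fin fg ?inE// ltW//.
  apply: ge0_subset_integral => //.
  - exact: measurable_box.
  - by apply/measurable_EFinP; exact: measurable_funX.
  - by move=> x _; rewrite lee_fin sqr_ge0.
  - by move=> x /eB[].
rewrite integral_cst; last exact: measurable_box.
rewrite [X in (_ * X)%E](_ : _ = ((e *+ 2) ^+ n)%:E); last first.
  exact: rV_lebesgue_box.
have -> : (\int[mu]_(x in D) (f x ^+ 2)%:E)%E = 0%:E.
  rewrite -[LHS]fineK; last exact: integrable_fin_num.
  congr EFin; rewrite -lf0.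
  by apply: eq_Rintegral => x _; rewrite expr2.
rewrite -EFinM lee_fin leNgt mulr_gt0// exprn_gt0// pmulrn_lgt0//.
Qed.

End square_integrable.

(** * Polynomials on subsets *)

Section polynomial_on.
Context (R : realType) (n : nat).
Implicit Types (D : set 'rV[R]_n) (f g : 'rV[R]_n -> R).

Lemma polynomial_on_polyfun k D f : polynomial_on k D f ->
  exists2 g, polyfun g & forall x, D x -> f x = g x.
Proof.
by move=> [p [_ fp]]; exists (fun x => mpoly.meval (fun i => x ord0 i) p) =>
  //; exact: polyfun_meval.
Qed.

Lemma polynomial_on_subspace k D : linear_subspace (polynomial_on k D).
Proof.
split; first by exists 0; rewrite mpoly.msize0; split => // x _;
  rewrite mpoly.meval0.
move=> a f g [p [sp fp]] [q [sq gq]]; exists (a *: p + q); split.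
  rewrite (leq_trans (mpoly.msizeD_le _ _))// geq_max sq andbT.
  exact: leq_trans (mpoly.msizeZ_le _ _) sp.
by move=> x Dx; rewrite mpoly.mevalD mpoly.mevalZ -fp// -gq.
Qed.

End polynomial_on.

(** The three discrete spaces are spaces of functions that are polynomial on
    each of finitely many regions: cells, components on cells, or faces.  The
    map [ev j] selects the scalar function to be looked at on the region j. *)
Section piecewise_polynomials.
Context (R : realType) (n : nat) (X : lmodType R) (J : finType) (k : nat).
Context (D : J -> set 'rV[R]_n) (ev : J -> X -> 'rV[R]_n -> R).
Hypothesis evL : forall j a x y pt, ev j (a *: x + y) pt = a * ev j x pt + ev j
  y pt.

Definition poly_coords (x : X) (c : nat -> R) : Prop :=
  forall j pt, D j pt -> ev j x pt =
    \sum_(m : mpoly.bmultinom n k.+1)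
      c (enum_rank (j, m)) * \prod_i pt ord0 i ^+ (m : mpoly.multinom n) i.

Lemma poly_coords_linear a x y c d : poly_coords x c -> poly_coords y d ->
  poly_coords (a *: x + y) (fun i => a * c i + d i).
Proof.
move=> xc yd j pt Dpt; rewrite evL (xc j)// (yd j)// mulr_sumr -big_split/=.
by apply: eq_bigr => m _; rewrite mulrDl mulrA.
Qed.

Lemma poly_coords0 x j pt : poly_coords x (fun=> 0) -> D j pt -> ev j x pt = 0.
Proof. by move=> x0 Dpt; rewrite (x0 j)// big1// => m _; rewrite mul0r. Qed.

Lemma poly_coords_exists x : (forall j, polynomial_on k (D j) (ev j x)) ->
  exists2 c, poly_coords x c &
    forall i, (#|{: J * mpoly.bmultinom n k.+1}| <= i)%N -> c i = 0.
Proof.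
move=> /choice[p pP].
exists (fun i => if insub i is Some i' then
   let jm := enum_val (i' : 'I_#|{: J * mpoly.bmultinom n k.+1}|) in
   mpoly.mcoeff jm.2 (p jm.1) else 0).
  move=> j pt Dpt; have [sp ->//] := pP j.
  rewrite [p j in LHS](mpoly.mpolywE sp) raddf_sum /=.
  apply: eq_bigr => m _; rewrite mpoly.mevalZ mpoly.mevalX.
  by rewrite valK enum_rankK.
by move=> i; rewrite leqNgt => il; rewrite insubF//; exact/negbTE.
Qed.

End piecewise_polynomials.

(** * Geometry of simplices *)

Section simplex_geometry.
Context (R : realType) (n : nat) (V : finType) (pos : V -> 'rV[R]_n.+1).
Implicit Types K E : {set V}.

Lemma open_simplex_bounded K :
  exists2 e, 0 < e & open_simplex pos K `<=` box 0 e.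
Proof.
exists (1 + \sum_(v in K) \sum_j `|pos v ord0 j|).
  by rewrite ltr_pwDl// sumr_ge0// => v _; rewrite sumr_ge0.
move=> x [a [a0 a1 ->]] i; rewrite mxE subr0 summxE.
rewrite (le_trans (ler_norm_sum _ _ _))// ler_wpDl// ler_sum// => v vK.
have av1 : a v <= 1.
  rewrite -a1 (bigD1 v)//= lerDl sumr_ge0// => w /andP[wK _].
  by rewrite ltW// a0.
rewrite mxE normrM ger0_norm; last by rewrite ltW// a0.
rewrite (le_trans (ler_piMl _ av1))// (bigD1 i)//= lerDl sumr_ge0//.
Qed.

(** Barycentric coordinates: affine independence makes the matrix of the
    homogenised vertices (1, v) invertible, and its inverse gives the
    coordinates as affine functions, whose positivity defines the simplex. *)
Lemma simplex_coordinates K : #|K| = n.+2 -> affinely_independent pos K ->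
  exists b : V -> 'rV[R]_n.+1 -> R, (forall v, polyfun (b v)) /\
    open_simplex pos K = [set x | forall v, v \in K -> 0 < b v x].
Proof.
move=> cK aff.
have [v0 v0K] : exists v, v \in K by apply/card_gt0P; rewrite cK.
pose rk := enum_rank_in v0K.
have rkK v : v \in K -> enum_val (rk v) = v by exact: enum_rankK_in.
pose hom x : 'rV[R]_n.+2 := rV_cons (1, x).
pose A : 'M[R]_(#|K|, n.+2) := \matrix_i hom (pos (enum_val i)).
have AE (c : 'rV[R]_#|K|) : c *m A =
    rV_cons (\sum_i c ord0 i, \sum_i c ord0 i *: pos (enum_val i)).
  rewrite mulmx_sum_row; apply/rowP => j; rewrite summxE mxE.
  case: (unliftP ord0 j) => [j' ->|->].
    by rewrite summxE; apply: eq_bigr => i _; rewrite rowK !mxE liftK.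
  by apply: eq_bigr => i _; rewrite rowK !mxE unlift_none mulr1.
have sumK (U : nmodType) (F : V -> U) :
    \sum_(v in K) F v = \sum_(i < #|K|) F (enum_val i).
  by rewrite big_enum_val.
have rV_cons_inj : injective (@rV_cons R n.+1) by exact: can_inj (@rV_consK _
  _).
have Afree : row_free A.
  apply: inj_row_free => c.
  have -> : 0 = rV_cons (0, 0) :> 'rV[R]_n.+2.
    by apply/rowP => j; rewrite !mxE; case: unliftP => [j' _|_]; rewrite ?mxE.
  rewrite AE => /rV_cons_inj[c1 c2]; apply/rowP => i; rewrite mxE.
  have := aff (fun v => c ord0 (rk v)); rewrite !sumK.
  under eq_bigr do rewrite /rk enum_valK_in.
  under [in X in _ -> X -> _]eq_bigr do rewrite /rk enum_valK_in.
  move=> /(_ c1 c2 (enum_val i) (enum_valP i)).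
  by rewrite /rk enum_valK_in.
have Afull : row_full A by rewrite /row_full (eqP Afree) cK.
pose co x := hom x *m pinvmx A.
exists (fun v x => co x ord0 (rk v)); split.
  move=> v; apply: (@polyfun_comp _ _ _ (fun y => (y *m pinvmx A) ord0 (rk v))
    hom).
    exact: polyfun_linear.
  move=> j; case: (unliftP ord0 j) => [j' ->|->].
    rewrite (_ : (fun _ => _) = fun x : 'rV[R]_n.+1 => x ord0 j').
      exact: polyfun_coord.
    by apply/funext => x; rewrite mxE liftK.
  rewrite (_ : (fun _ => _) = fun=> 1); first exact: polyfun_cst.
  by apply/funext => x; rewrite mxE unlift_none.
have coE x : co x *m A = hom x by rewrite mulmxKpV// submx_full.
apply/seteqP; split => x /=.
  move=> [a [a0 a1 xa]] v vK.
  have -> : co x = \row_i a (enum_val i).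
    apply: (row_free_inj Afree); rewrite coE AE /hom; congr (rV_cons (_, _)).
      by rewrite -a1 sumK; apply: eq_bigr => i _; rewrite mxE.
    by rewrite xa sumK; apply: eq_bigr => i _; rewrite mxE.
  by rewrite mxE rkK// a0.
move=> x0; exists (fun v => co x ord0 (rk v)); have := coE x.
rewrite AE => /rV_cons_inj[x1 x2]; split=> //; rewrite sumK.
  by under eq_bigr do rewrite /rk enum_valK_in.
by under eq_bigr do rewrite /rk enum_valK_in.
Qed.

Lemma open_open_simplex K : #|K| = n.+2 -> affinely_independent pos K ->
  open (open_simplex pos K).
Proof.
move=> cK aff; have [b [pb ->]] := simplex_coordinates cK aff.
apply: (@open_forall _ _ (fun v => [set x | v \in K -> 0 < b v x])) => v.
have [vK|vK] := boolP (v \in K).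
  rewrite (_ : [set x | _] = [set x | 0 < b v x]); first exact: open_polyfun_gt.
  by apply/seteqP; split => x /=; [apply|].
by rewrite (_ : [set x | _] = setT); [exact: openT|apply/seteqP; split].
Qed.

(** Moving slightly from a point of a face towards the barycentre of the simplex
    makes all barycentric coordinates positive. *)
Lemma closure_open_simplex K E x : E \subset K -> open_simplex pos E x ->
  closure (open_simplex pos K) x.
Proof.
move=> EK [a [a0 a1 xE]] B /nbhs_box[e e0 eB].
have [v0 v0E] : exists v, v \in E.
  have [//|E0] := pselect (exists v, v \in E).
  move: a1; rewrite big1 => [/eqP|v vE]; first by rewrite eq_sym oner_eq0.
  by exfalso; apply: E0; exists v.
have v0K := fintype.subsetP EK _ v0E.
pose c := \sum_(v in K) #|K|%:R^-1 *: pos v.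
pose M := 1 + \sum_i `|(c - x) ord0 i|.
have M0 : 0 < M by rewrite ltr_pwDl// sumr_ge0.
(* t < 1 and t |c - x| <= e hold together for this t *)
pose t := e / (e + M).
have eM0 : 0 < e + M by rewrite addr_gt0.
have t0 : 0 < t by rewrite divr_gt0.
have t1 : t < 1 by rewrite /t ltr_pdivrMr// mul1r ltrDl.
have K0 : 0 < #|K|%:R :> R by rewrite ltr0n; apply/card_gt0P; exists v0.
have extE (U : nmodType) (F : V -> U) :
    \sum_(v in K) (if v \in E then F v else 0) = \sum_(v in E) F v.
  rewrite -big_mkcondr; apply: eq_bigl => v.
  by apply/andP/idP => [[]//|vE]; split => //; exact: (fintype.subsetP EK).
exists (x + t *: (c - x)); split.
  exists (fun v => (1 - t) * (if v \in E then a v else 0) + t * #|K|%:R^-1);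
    split.
  - move=> v vK; rewrite ltr_wpDl//; last by rewrite mulr_gt0// invr_gt0.
    rewrite mulr_ge0// ?subr_ge0 ?(ltW t1)//; case: ifPn => // vE.
    by rewrite ltW// a0.
  - rewrite big_split/= -!mulr_sumr extE a1 sumr_const -[_ *+ #|K|]mulr_natr.
    by rewrite mulVf ?gt_eqF// !mulr1 subrK.
  - have x'E : x = \sum_(v in K) (if v \in E then a v else 0) *: pos v.
      by rewrite xE -extE; apply: eq_bigr => v _; case: ifP; rewrite // scale0r.
    transitivity ((1 - t) *: x + t *: c).
      by rewrite scalerBl scale1r scalerBr addrA addrAC.
    rewrite [in X in X + _]x'E /c !scaler_sumr -big_split/=.
    by apply: eq_bigr => v _; rewrite !scalerA -scalerDl.
apply: eB => i; rewrite mxE addrAC subrr add0r mxE normrM gtr0_norm//.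
rewrite /t -mulrA ler_piMr//; first exact: ltW.
rewrite mulrC ler_pdivrMr// mul1r ler_wpDl//; first exact: ltW.
by rewrite /M (bigD1 i)//= addrCA lerDl addr_ge0// sumr_ge0.
Qed.

End simplex_geometry.

(** * Integration on faces *)

Section ref_simplex.
Context (R : realType) (n : nat).

Lemma open_ref_simplex : open (@ref_simplex R n).
Proof.
have psum : polyfun (fun s : 'rV[R]_n => \sum_i s ord0 i).
  by apply: polyfun_sum => i; exact: polyfun_coord.
rewrite (_ : @ref_simplex R n =
  [set s : 'rV[R]_n | forall i, 0 < s ord0 i] `&`
    [set s : 'rV[R]_n | -1 < -1 * \sum_i s ord0 i]); last first.
  by apply/seteqP; split => s /= []; rewrite mulN1r ltrN2.
apply: openI; last first.
  by apply: open_polyfun_gt; apply: polyfunM => //; exact: polyfun_cst.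
apply: open_forall => i; apply: open_polyfun_gt; exact: polyfun_coord.
Qed.

Lemma ref_simplex_bounded : @ref_simplex R n `<=` box 0 1.
Proof.
move=> s [s0 s1] i; rewrite mxE subr0 gtr0_norm// (le_trans _ (ltW s1))//.
by rewrite (bigD1 i)//= lerDl sumr_ge0// => j _; exact: ltW.
Qed.

End ref_simplex.

Section faces.
Context (R : realType) (n : nat) (T : mesh R n).
Local Notation V := (vertex T).
Implicit Types (E : {set V}) (f g : 'rV[R]_n.+1 -> R).

(** The image of s has barycentric coordinates 1 - sum s, s_0, ..., s_(n-1) with
    respect to the vertices in the order of [enum E]. *)
Lemma face_map_face E s : #|E| = n.+1 -> ref_simplex s -> face E (face_map E s).
Proof.
move=> cE [s0 s1].
have [v0 v0E] : exists v, v \in E by apply/card_gt0P; rewrite cE.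
have szE : size (enum E) = n.+1 by rewrite -cardE.
have fvE i : (i < n.+1)%N -> face_vertex E i = pos (nth v0 (enum E) i).
  by move=> iE; rewrite /face_vertex (nth_map v0)// szE.
pose c : 'I_n.+1 -> R := fun i =>
  if unlift ord0 i is Some j then s ord0 j else 1 - \sum_j s ord0 j.
have sumE (U : nmodType) (F : V -> U) :
    \sum_(v in E) F v = \sum_(i < n.+1) F (nth v0 (enum E) i).
  by rewrite -big_enum/= (big_nth v0) szE big_mkord.
pose a v := if insub (index v (enum E)) is Some i then c i else 1.
have aE (i : 'I_n.+1) : a (nth v0 (enum E) i) = c i.
  by rewrite /a index_uniq ?enum_uniq ?szE// valK.
exists a; split.
- move=> v vE; rewrite /a; case: insubP => // i _ _; rewrite /c.
  by case: unlift => [j|]; rewrite ?s0 ?subr_gt0.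
- rewrite sumE; under eq_bigr do rewrite aE.
  rewrite big_ord_recl /c unlift_none.
  by under [X in _ + X]eq_bigr do rewrite liftK; rewrite subrK.
rewrite sumE; under eq_bigr do rewrite aE.
rewrite big_ord_recl /c unlift_none; under [X in _ = _ + X]eq_bigr do rewrite
  liftK.
have -> : face_map E s = face_vertex E 0 +
    \sum_j s ord0 j *: (face_vertex E j.+1 - face_vertex E 0).
  rewrite /face_map mulmx_sum_row; congr (_ + _); apply: eq_bigr => j _.
  by congr (_ *: _); apply/rowP => l; rewrite !mxE.
transitivity (pos (nth v0 (enum E) 0) + \sum_(j < n)
    (s ord0 j *: pos (nth v0 (enum E) j.+1) -
     s ord0 j *: pos (nth v0 (enum E) 0))).
  rewrite fvE//; congr (_ + _); apply: eq_bigr => j _.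
  by rewrite scalerBr fvE ?ltnS.
by rewrite sumrB -scaler_suml scalerBl scale1r addrA addrAC.
Qed.

Lemma polyfun_face_map E i : polyfun (fun s => (face_map E s) ord0 i).
Proof.
rewrite (_ : (fun _ => _) = fun s => face_vertex E 0 ord0 i +
  (s *m face_jacobian E) ord0 i); last by apply/funext => s; rewrite mxE.
by apply: polyfunD; [exact: polyfun_cst|exact: polyfun_linear].
Qed.

Definition face_inner E f g : R := face_integral E (fun x => f x * g x).

Let mref := open_measurable_rV (@open_ref_simplex R n).

Lemma face_square_integrable_subspace E :
  linear_subspace (face_square_integrable E).
Proof.
have [S0 SZ] := square_integrable_subspace mref.
by split=> [|a f g]; [exact: S0|exact: SZ].
Qed.

Lemma face_semi_inner E : semi_inner (face_square_integrable E) (face_inner E).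
Proof.
have [gC gL g0] := L2_semi_inner mref.
split.
- by move=> f g sf sg; rewrite /face_inner /face_integral; congr (_ * _);
    exact: gC.
- move=> g sg a f1 f2 sf1 sf2; rewrite /face_inner /face_integral.
  have := gL _ sg a _ _ sf1 sf2; rewrite /L2_inner/= => ->.
  by rewrite mulrDr mulrCA.
- by move=> f sf; rewrite mulr_ge0 ?sqrtr_ge0//; exact: g0.
Qed.

Lemma eq_face_integral E f g : #|E| = n.+1 -> (forall x, face E x -> f x = g x)
  ->
  face_integral E f = face_integral E g.
Proof.
move=> cE fg; congr (_ * _); apply: eq_Rintegral => s /set_mem refs.
by rewrite fg//; exact: face_map_face.
Qed.

Lemma face_polynomial_square_integrable k E f : #|E| = n.+1 ->
  polynomial_on k (face E) f -> face_square_integrable E f.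
Proof.
move=> cE /polynomial_on_polyfun[g pg fg].
apply: (@eq_square_integrable _ _ _ (g \o face_map E)).
  by move=> s /set_mem refs /=; rewrite fg//; exact: face_map_face.
apply: polyfun_square_integrable mref ltr01 (@ref_simplex_bounded R n) _.
exact: polyfun_comp pg (polyfun_face_map E).
Qed.

(** The projection is only determined up to null vectors of the L^2(E) product,
    but its products with polynomials of degree k are those of w, which is all
    that the stabilisation uses.  It exists by Riesz representation. *)
Lemma face_projectionP k E w : #|E| = n.+1 -> face_square_integrable E w ->
  polynomial_on k (face E) (face_projection k E w) /\
  forall z, polynomial_on k (face E) z ->
    face_inner E (face_projection k E w) z = face_inner E w z.
Proof.
move=> cE sw.
pose S : set ('rV[R]_n.+1 -> R) := polynomial_on k (face E).
have subS : linear_subspace S by exact: polynomial_on_subspace.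
have SL : S `<=` face_square_integrable E.
  by move=> f; exact: face_polynomial_square_integrable.
have gL := face_semi_inner E; have subL := face_square_integrable_subspace E.
have gS : semi_inner S (face_inner E).
  have [g1 g2 g3] := gL; split.
  - by move=> x y /SL ? /SL ?; exact: g1.
  - by move=> y /SL Sy a x z /SL Sx /SL Sz; exact: g2.
  - by move=> x /SL; exact: g3.
pose ev (_ : unit) (x : 'rV[R]_n.+1 -> R) := x.
have evL : forall j a x y pt, ev j (a *: x + y) pt = a * ev j x pt + ev j y pt
  by [].
have [||r [e eS]] := @orthonormal_basis_exists _ _ S (face_inner E)
    (poly_coords k (fun _ => face E) ev)
    #|{: unit * mpoly.bmultinom n.+1 k.+1}| subS gS.
- split=> [a x y c d|x Sx x0]; first exact: poly_coords_linear.
  rewrite /face_inner (eq_face_integral (g := fun=> 0))//.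
    by rewrite /face_integral Rintegral_cst// mul0r mulr0.
  by move=> y Ey; rewrite (_ : x y = 0) ?mulr0//;
    exact: (poly_coords0 (j := tt) x0 Ey).
- by move=> x Sx; apply: poly_coords_exists.
have [Se _ _] := eS.
pose p := comb e (\row_i face_inner E w (e i)).
have Sp : S p by exact: linear_subspace_comb.
have pz z : S z -> face_inner E p z = face_inner E w z.
  move=> Sz; apply: (riesz subS gS eS (l := face_inner E w)) => //.
  - by move=> a x y /SL Sx /SL Sy; exact: (semi_inner_linr subL gL).
  - move=> y /SL Sy y0; rewrite (semi_innerC gL)//.
    exact: (semi_inner_null subL gL).
rewrite /face_projection; case: xgetP => [q -> [Sq qz]|/(_ p)]; last first.
  case; split=> // z Sz; have := pz z Sz => /eqP; rewrite -subr_eq0 => /eqP.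
  rewrite -(linear_onB (semi_inner_linl gL (SL _ Sz)))//; exact: SL.
split=> // z Sz; apply/eqP; rewrite -subr_eq0; apply/eqP.
rewrite -(linear_onB (semi_inner_linl gL (SL _ Sz)))//; last exact: SL.
exact: qz.
Qed.

End faces.

Lemma Rintegral_sum d (S : measurableType d) (R : realType)
    (mu : {measure set S -> \bar R}) (D : set S) (I : Type) (r : seq I)
    (F : I -> S -> R) : measurable D ->
  (forall i, mu.-integrable D (EFin \o F i)) ->
  \int[mu]_(x in D) (\sum_(i <- r) F i x) = \sum_(i <- r) \int[mu]_(x in D) F i
    x.
Proof.
move=> mD iF; elim: r => [|i r IH].
  rewrite big_nil; under eq_Rintegral do rewrite big_nil.
  by rewrite Rintegral_cst// mul0r.
rewrite big_cons -IH; under eq_Rintegral do rewrite big_cons.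
rewrite RintegralD//.
rewrite (_ : _ \o _ = fun x => (\sum_(j <- r) (F j x)%:E)%E).
  by apply: (integrable_sum mD) => j _; exact: iF.
by apply/funext => x /=; rewrite sumEFin.
Qed.

(** * Broken spaces, derivatives and traces on the cells *)

Section cells.
Context (R : realType) (n : nat) (Omega : set 'rV[R]_n.+1) (T : mesh R n).
Hypothesis tri : triangulation T Omega.
Local Notation V := (vertex T).
Local Notation point := 'rV[R]_n.+1.
Implicit Types (K E : {set V}) (u w : point -> R) (q r : point -> point).

Lemma open_cell K : K \in cells T -> open (cell K).
Proof. by case: tri => + _ _ _ => /[apply] -[]; exact: open_open_simplex. Qed.

Lemma measurable_cell K : K \in cells T -> measurable (cell K).
Proof. by move=> KT; apply: open_measurable_rV; exact: open_cell. Qed.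

Lemma card_face K E : E \in faces_of K -> #|E| = n.+1.
Proof. by rewrite inE => /andP[_ /eqP]. Qed.

Definition brokenL2 : set (point -> R) :=
  [set u | forall K, K \in cells T -> square_integrable (cell K) u].

Definition pw_polynomial : set (point -> R) := [set u | forall K, K \in cells T
  ->
  exists2 g, polyfun g & forall x, cell K x -> u x = g x].

Lemma pw_polynomialM u w : pw_polynomial u -> pw_polynomial w -> pw_polynomial
  (fun x => u x * w x).
Proof.
move=> pu pw K KT; have [g pg ug] := pu _ KT; have [g' pg' wg'] := pw _ KT.
exists (fun x => g x * g' x); first exact: polyfunM.
by move=> x Kx; rewrite ug// wg'.
Qed.

Lemma pw_polynomial_cst c : pw_polynomial (fun=> c).
Proof. by move=> K KT; exists (fun=> c) => //; exact: polyfun_cst. Qed.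

Lemma pw_polynomial_subspace : linear_subspace pw_polynomial.
Proof.
split; first exact: (pw_polynomial_cst 0).
move=> a u w pu pw K KT; have [g pg ug] := pu _ KT;
  have [g' pg' wg'] := pw _ KT.
exists (fun x => a * g x + g' x).
  by apply: polyfunD => //; apply: polyfunM => //; exact: polyfun_cst.
by move=> x Kx; rewrite -ug// -wg'.
Qed.

Lemma pw_polynomial_brokenL2 : pw_polynomial `<=` brokenL2.
Proof.
move=> u pu K KT; have [g pg ug] := pu _ KT.
have [e e0 Ke] := open_simplex_bounded (@pos _ _ T) K.
apply: (@eq_square_integrable _ _ _ g); first by move=> x /set_mem Kx;
  rewrite ug.
exact: polyfun_square_integrable (measurable_cell KT) e0 Ke pg.
Qed.

Lemma brokenL2_subspace : linear_subspace brokenL2.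
Proof.
split=> [K KT|a u w Lu Lw K KT].
  by case: (square_integrable_subspace (measurable_cell KT)).
apply: (square_integrable_subspace (measurable_cell KT)).2;
  [exact: Lu|exact: Lw].
Qed.

Lemma brokenL2_restrict u : open Omega -> square_integrable Omega u -> brokenL2
  u.
Proof.
move=> oO su K KT; apply: square_integrableS su.
- exact: open_measurable_rV.
- exact: measurable_cell.
- by case: tri => _ _ _; exact.
Qed.

Lemma inner_semi_inner : semi_inner brokenL2 (inner T).
Proof.
split.
- by move=> u w _ _; apply: eq_bigr => K _; apply: eq_Rintegral => x _;
    rewrite mulrC.
- move=> w Lw a u u' Lu Lu'; rewrite /inner mulr_sumr -big_split/=.
  apply: eq_bigr => K KT.
  exact: (semi_inner_linl (L2_semi_inner (measurable_cell KT)) (Lw _ KT) a (Lu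
    _ KT) (Lu' _ KT)).
- move=> u Lu; rewrite /inner sumr_ge0// => K KT.
  exact: (semi_inner_ge0 (L2_semi_inner (measurable_cell KT)) (Lu _ KT)).
Qed.

Lemma eq_inner u w u' w' :
  (forall K x, K \in cells T -> cell K x -> u x * w x = u' x * w' x) ->
  inner T u w = inner T u' w'.
Proof.
move=> uw; apply: eq_bigr => K KT; apply: eq_Rintegral => x /set_mem Kx.
exact: uw Kx.
Qed.

Lemma inner_eq0 u : pw_polynomial u -> inner T u u = 0 ->
  forall K x, K \in cells T -> cell K x -> u x = 0.
Proof.
move=> pu uu0 K x KT Kx; have [g pg ug] := pu _ KT.
apply: (@L2_polyfun_eq0 _ _ (cell K) u g) => //.
- exact: open_cell.
- exact: pw_polynomial_brokenL2.
- by move=> y /set_mem Ky; rewrite ug.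
- have ge0 K' : K' \in cells T -> 0 <= L2_inner (cell K') u u.
    move=> K'T; exact: (semi_inner_ge0 (L2_semi_inner (measurable_cell K'T))
      (pw_polynomial_brokenL2 pu K'T)).
  apply/eqP; move/eqP: uu0; rewrite psumr_eq0// => /allP/(_ K).
  by rewrite mem_index_enum KT => /(_ isT).
- exact/mem_set.
Qed.

Definition coordinate q i : point -> R := fun x => q x ord0 i.

Definition brokenL2v : set (point -> point) := [set q | forall i, brokenL2
  (coordinate q i)].

Lemma vinnerE q r : brokenL2v q -> brokenL2v r ->
  vinner T q r = \sum_i inner T (coordinate q i) (coordinate r i).
Proof.
move=> Lq Lr; rewrite /vinner /inner exchange_big/=; apply: eq_bigr => K KT.
rewrite /dotp Rintegral_sum//; first exact: measurable_cell.
move=> i; apply: square_integrableM; first exact: measurable_cell.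
  exact: Lq.
exact: Lr.
Qed.

Lemma brokenL2v_subspace : linear_subspace brokenL2v.
Proof.
have [L0 LZ] := brokenL2_subspace.
split=> [i|a q r Lq Lr i].
  by rewrite (_ : coordinate 0 i = 0)//; apply/funext => x;
    rewrite /coordinate mxE.
rewrite (_ : coordinate _ i = a *: coordinate q i + coordinate r i);
  first exact: LZ.
by apply/funext => x; rewrite /coordinate !mxE.
Qed.

Lemma coordinate_linear a q r i : coordinate (a *: q + r) i = a *: coordinate q
  i + coordinate r i.
Proof. by apply/funext => x; rewrite /coordinate !mxE. Qed.

Lemma vinner_semi_inner : semi_inner brokenL2v (vinner T).
Proof.
have gL := inner_semi_inner.
split.
- move=> q r Lq Lr; rewrite !vinnerE//; apply: eq_bigr => i _.
  by rewrite (semi_innerC gL).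
- move=> r Lr a q q' Lq Lq'; rewrite !vinnerE//;
    last exact: brokenL2v_subspace.2.
  rewrite mulr_sumr -big_split/=; apply: eq_bigr => i _.
  by rewrite coordinate_linear (semi_inner_linl gL).
- by move=> q Lq; rewrite vinnerE// sumr_ge0// => i _;
    exact: (semi_inner_ge0 gL).
Qed.

Lemma vinner_eq0 q : (forall i, pw_polynomial (coordinate q i)) -> vinner T q q
  = 0 ->
  forall i K x, K \in cells T -> cell K x -> coordinate q i x = 0.
Proof.
move=> pq; have Lq i : brokenL2 (coordinate q i) by exact:
  pw_polynomial_brokenL2.
rewrite vinnerE// => /eqP; rewrite psumr_eq0; last first.
  by move=> i _; exact: (semi_inner_ge0 inner_semi_inner).
move=> /allP q0 i K x KT Kx; apply: (@inner_eq0 _ (pq i) _ K) => //.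
by apply/eqP; apply: q0; exact: mem_index_enum.
Qed.

Lemma divergence_polyfun q K : K \in cells T -> (forall i, pw_polynomial
  (coordinate q i)) ->
  exists2 g, polyfun g & forall x, cell K x ->
  (forall i, derivable (coordinate q i) x (delta_mx ord0 i)) /\ divergence q x
    = g x.
Proof.
move=> KT pq.
have /choice[g gP] : forall i, exists g, polyfun g /\
    forall x, cell K x -> is_derive x (delta_mx ord0 i) (coordinate q i) (g x).
  move=> i; have [f pf qf] := pq i _ KT.
  have [g pg dg] := polyfun_derive (delta_mx ord0 i) pf.
  exists g; split => // x Kx; apply: near_eq_is_derive (dg x).
  have : nbhs x (cell K) by apply: open_nbhs_nbhs; split => //;
    exact: open_cell.
  by apply: filterS => y Ky; rewrite qf.
exists (fun x => \sum_i g i x); first by apply: polyfun_sum => i; case: (gP i).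
move=> x Kx; split; first by move=> i; case: (gP i) => _ /(_ x Kx)[].
by apply: eq_bigr => i _; case: (gP i) => _ /(_ x Kx)[].
Qed.

Lemma divergence_pw_polynomial q : (forall i, pw_polynomial (coordinate q i))
  -> pw_polynomial (divergence q).
Proof.
move=> pq K KT; have [g pg gP] := divergence_polyfun KT pq.
by exists g => // x Kx; case: (gP x Kx).
Qed.

Lemma divergence_linear a q r K x : (forall i, pw_polynomial (coordinate q i))
  ->
  (forall i, pw_polynomial (coordinate r i)) -> K \in cells T -> cell K x ->
  divergence (a *: q + r) x = a * divergence q x + divergence r x.
Proof.
move=> pq pr KT Kx.
have [_ _ /(_ x Kx)[dq _]] := divergence_polyfun KT pq.
have [_ _ /(_ x Kx)[dr _]] := divergence_polyfun KT pr.
rewrite /divergence mulr_sumr -big_split/=; apply: eq_bigr => i _.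
rewrite -[fun y => (a *: q + r) y ord0 i]/(coordinate (a *: q + r) i)
  coordinate_linear.
rewrite deriveD//; last exact: derivableZ.
by rewrite deriveZ.
Qed.

Lemma divergence0 q K x : (forall i y, cell K y -> coordinate q i y = 0) ->
  K \in cells T -> cell K x -> divergence q x = 0.
Proof.
move=> q0 KT Kx; rewrite /divergence big1// => i _.
rewrite (near_eq_derive (g := cst 0)); first exact: derive_cst.
have : nbhs x (cell K) by apply: open_nbhs_nbhs; split => //; exact: open_cell.
by apply: filterS => y Ky; exact: (q0 i).
Qed.

(** A point of a face is in the closure of the open cell, so that the limit
    defining the trace is taken along a proper filter and is unique. *)
Lemma traceE K E w g x : E \in faces_of K -> face E x ->
  polyfun g -> (forall y, cell K y -> w y = g y) -> trace K w x = g x.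
Proof.
rewrite inE => /andP[EK _] Ex pg wg.
have clx : closure (cell K) x by exact: closure_open_simplex EK Ex.
have FF := within_nbhs_proper (A := cell K) (p := x) clx.
apply: cvg_lim => //.
have gx : g y @[y --> within (cell K) (nbhs x)] --> g x.
  apply: (@cvg_within_filter _ _ g (nbhs x) (nbhs_filter x) (nbhs (g x)) (cell
    K)).
  exact: polyfun_continuous pg x.
apply: cvg_trans gx; apply: near_eq_cvg.
by rewrite near_withinE; near=> y => Ky; rewrite wg.
Unshelve. all: by end_near. Qed.

Lemma trace_linear K E a u w x : K \in cells T -> E \in faces_of K -> face E x
  ->
  pw_polynomial u -> pw_polynomial w ->
  trace K (a *: u + w) x = a * trace K u x + trace K w x.
Proof.
move=> KT EK Ex pu pw.
have [g pg ug] := pu _ KT; have [g' pg' wg'] := pw _ KT.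
rewrite (traceE EK Ex pg ug) (traceE EK Ex pg' wg').
rewrite (@traceE K E _ (fun x => a * g x + g' x))//.
  by apply: polyfunD => //; apply: polyfunM => //; exact: polyfun_cst.
by move=> y Ky; rewrite -ug// -wg'.
Qed.

Lemma trace0 K E w x : E \in faces_of K -> face E x ->
  (forall y, cell K y -> w y = 0) -> trace K w x = 0.
Proof.
move=> EK Ex w0.
by rewrite (@traceE K E w (fun=> 0))//; exact: polyfun_cst.
Qed.

Lemma trace_polynomial k K E w : E \in faces_of K ->
  polynomial_on k (cell K) w -> polynomial_on k (face E) (trace K w).
Proof.
move=> EK [p [sp wp]]; exists p; split=> // x Ex.
by apply: (traceE EK Ex _ wp); exact: polyfun_meval.
Qed.

End cells.

(** * The forms of the scheme *)

Section hdg_forms.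
Context (R : realType) (n : nat) (Omega : set 'rV[R]_n.+1) (T : mesh R n) (k :
  nat).
Hypotheses (tri : triangulation T Omega) (oO : open Omega).
Local Notation V := (vertex T).
Local Notation point := 'rV[R]_n.+1.
Local Notation SV := (Vh Omega T k).
Local Notation SW := (Wh Omega T k).
Local Notation SM := (Mh T k).
Implicit Types (K E : {set V}) (u w mu : point -> R) (q r : point -> point).
Implicit Types (y z : (point -> R) * (point -> R)).

Let SY : set ((point -> R) * (point -> R)) := [set y | SW y.1 /\ SM y.2].

Lemma Wh_subspace : linear_subspace SW.
Proof.
have [S0 SZ] := square_integrable_subspace (open_measurable_rV oO).
split; first by split=> // K KT; case: (polynomial_on_subspace k.+1 (cell K)).
move=> a u w [su pu] [sw pw]; split; first exact: SZ.
by move=> K KT; apply: (polynomial_on_subspace k.+1 (cell K)).2;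
  [exact: pu|exact: pw].
Qed.

Lemma Vh_subspace : linear_subspace SV.
Proof.
have [S0 SZ] := square_integrable_subspace (open_measurable_rV oO).
split.
  move=> i; have -> : (fun x => (0 : point -> point) x ord0 i) = 0.
    by apply/funext => x; rewrite mxE.
  by split=> // K KT; case: (polynomial_on_subspace k (cell K)).
move=> a q r qV rV i; have := coordinate_linear a q r i;
  rewrite /coordinate => ->.
have [sq pq] := qV i; have [sr pr] := rV i; split; first exact: SZ.
by move=> K KT; apply: (polynomial_on_subspace k (cell K)).2;
  [exact: pq|exact: pr].
Qed.

Lemma card_faces E : E \in faces T -> #|E| = n.+1.
Proof. by rewrite inE => /existsP[K /andP[_]]; exact: card_face. Qed.

Lemma faces_of_faces K E : K \in cells T -> E \in faces_of K -> E \in faces T.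
Proof. by move=> KT EK; rewrite inE; apply/existsP; exists K; rewrite KT. Qed.

Lemma MhP mu : SM mu <-> forall E, E \in faces T -> polynomial_on k (face E) mu.
Proof.
split=> [muM E /muM[]//|pmu E ET]; split; last exact: pmu.
by apply: face_polynomial_square_integrable (pmu _ ET); exact: card_faces.
Qed.

Lemma Mh_subspace : linear_subspace SM.
Proof.
split; first by apply/MhP => E _; case: (polynomial_on_subspace k (face E)).
move=> a mu nu /MhP Mmu /MhP Mnu; apply/MhP => E ET.
by apply: (polynomial_on_subspace k (face E)).2; [exact: Mmu|exact: Mnu].
Qed.

Lemma Wh_pw_polynomial : SW `<=` pw_polynomial T.
Proof.
by move=> w [_ pw] K KT; have [g pg wg] := polynomial_on_polyfun (pw _ KT);
  exists g.
Qed.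

Lemma Vh_pw_polynomial q i : SV q -> pw_polynomial T (coordinate q i).
Proof.
move=> /(_ i)[_ pq] K KT.
by have [g pg wg] := polynomial_on_polyfun (pq _ KT); exists g.
Qed.

Let subL := brokenL2_subspace tri.
Let gL := inner_semi_inner tri.

Lemma inner_Wh_semi_inner : semi_inner SW (inner T).
Proof.
have WL u : SW u -> brokenL2 T u by move=> /Wh_pw_polynomial;
  exact: (pw_polynomial_brokenL2 tri).
have [g1 g2 g3] := gL; split.
- by move=> u w /WL ? /WL ?; exact: g1.
- by move=> w /WL Lw a u u' /WL Lu /WL Lu'; exact: g2.
- by move=> u /WL; exact: g3.
Qed.

Lemma vinner_Vh_semi_inner : semi_inner SV (vinner T).
Proof.
have VL q : SV q -> brokenL2v T q by move=> qV i;
  apply: (pw_polynomial_brokenL2 tri); exact: Vh_pw_polynomial.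
have [g1 g2 g3] := vinner_semi_inner tri; split.
- by move=> u w /VL ? /VL ?; exact: g1.
- by move=> w /VL Lw a u u' /VL Lu /VL Lu'; exact: g2.
- by move=> u /VL; exact: g3.
Qed.

Lemma normal_traceE K E q :
  normal_trace K E q = fun x => \sum_i trace K (coordinate q i) x *
    outward_normal K E ord0 i.
Proof. by apply/funext => x; apply: eq_bigr => i _; rewrite mxE. Qed.

Lemma normal_trace_polynomial K E q : K \in cells T -> E \in faces_of K ->
  SV q -> polynomial_on k (face E) (normal_trace K E q).
Proof.
move=> KT EK qV; rewrite normal_traceE.
rewrite (_ : (fun _ => _) = \sum_i outward_normal K E ord0 i *: trace K
  (coordinate q i)).
  apply: linear_subspace_sum (polynomial_on_subspace k (face E)) _ => i.
  apply: linear_subspaceZ (polynomial_on_subspace k (face E)) _.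
  by apply: trace_polynomial => //; case: (qV i) => _; exact.
apply/funext => x; rewrite fct_sumE; apply: eq_bigr => i _.
by rewrite mulrC.
Qed.

Lemma normal_trace_linear K E a q r x : K \in cells T -> E \in faces_of K ->
  face E x -> SV q -> SV r ->
  normal_trace K E (a *: q + r) x = a * normal_trace K E q x + normal_trace K E
    r x.
Proof.
move=> KT EK Ex qV rV; rewrite !normal_traceE mulr_sumr -big_split/=.
apply: eq_bigr => i _; rewrite coordinate_linear (trace_linear _ KT EK Ex)
  ?mulrDl ?mulrA//.
  exact: Vh_pw_polynomial.
exact: Vh_pw_polynomial.
Qed.

Lemma normal_trace0 K E q x : E \in faces_of K -> face E x ->
  (forall i pt, cell K pt -> coordinate q i pt = 0) -> normal_trace K E q x = 0.
Proof.
move=> EK Ex q0; rewrite normal_traceE big1// => i _.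
by rewrite (trace0 EK Ex (q0 i)) mul0r.
Qed.

(** The two occurrences of the divergence and of the normal trace in A are the
    same bilinear form, once with the trial and once with the test functions;
    this antisymmetry makes A condense to a symmetric form. *)
Definition grad_form y r : R := inner T y.1 (divergence r)
  - boundary_inner (fun _ _ => y.2) (fun K E => normal_trace K E r).

Definition stab_form y z : R := boundary_inner
  (fun K E x => (h K)^-1 * (face_projection k E (trace K y.1) x - y.2 x))
  (fun K E x => face_projection k E (trace K z.1) x - z.2 x).

Lemma AformE q u uhat r w mu : Aform T k q u uhat r w mu =
  vinner T q r - grad_form (u, uhat) r + grad_form (w, mu) q
  + stab_form (u, uhat) (w, mu).
Proof.
rewrite /Aform /grad_form /=.
have -> : inner T (divergence q) w = inner T w (divergence q).
  by apply: eq_inner => K x _ _; rewrite mulrC.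
have -> : boundary_inner (fun K E => normal_trace K E q) (fun _ _ => mu) =
    boundary_inner (fun _ _ => mu) (fun K E => normal_trace K E q) :> R.
  apply: eq_bigr => K _; apply: eq_bigr => E _; congr (_ * _).
  by apply: eq_Rintegral => x _; rewrite mulrC.
by rewrite -/(stab_form (u, uhat) (w, mu)); ring.
Qed.

Let face_sq K E f j : K \in cells T -> E \in faces_of K ->
  polynomial_on j (face E) f -> face_square_integrable E f.
Proof.
by move=> KT EK; apply: face_polynomial_square_integrable; exact: card_face EK.
Qed.

Let SM_face K E mu : SM mu -> K \in cells T -> E \in faces_of K ->
  polynomial_on k (face E) mu.
Proof. by move=> /MhP muM KT EK; apply: muM; exact: faces_of_faces EK. Qed.

Let SV_div r : SV r -> brokenL2 T (divergence r).
Proof.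
move=> rV; apply: (pw_polynomial_brokenL2 tri);
  apply: divergence_pw_polynomial tri _ _ => i.
exact: Vh_pw_polynomial.
Qed.

Let SW_L2 u : SW u -> brokenL2 T u.
Proof. by move=> /Wh_pw_polynomial; exact: (pw_polynomial_brokenL2 tri). Qed.

Lemma grad_form_linearl r : SV r -> linear_on SY (grad_form^~ r).
Proof.
move=> rV a y z [y1 y2] [z1 z2]; rewrite /grad_form /=.
rewrite (semi_inner_linl gL (SV_div rV) a (SW_L2 y1) (SW_L2 z1)).
suff -> : boundary_inner (fun _ _ => a *: y.2 + z.2) (fun K E => normal_trace K
  E r) =
   a * boundary_inner (fun _ _ => y.2) (fun K E => normal_trace K E r) +
   boundary_inner (fun _ _ => z.2) (fun K E => normal_trace K E r) :> R by ring.
rewrite /boundary_inner mulr_sumr -big_split/=; apply: eq_bigr => K KT.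
rewrite mulr_sumr -big_split/=; apply: eq_bigr => E EK.
apply: (semi_inner_linl (@face_semi_inner _ _ _ E)).
- by apply: (face_sq KT EK); exact: normal_trace_polynomial.
- exact: (face_sq KT EK (SM_face y2 KT EK)).
- exact: (face_sq KT EK (SM_face z2 KT EK)).
Qed.

Lemma grad_form_linearr y : SY y -> linear_on SV (grad_form y).
Proof.
move=> [y1 y2] a q r qV rV; rewrite /grad_form.
have -> : inner T y.1 (divergence (a *: q + r)) =
    inner T y.1 (a *: divergence q + divergence r).
  apply: eq_inner => K x KT Kx; congr (_ * _).
  by apply: (divergence_linear tri a _ _ KT Kx) => i; exact: Vh_pw_polynomial.
rewrite (semi_inner_linr subL gL (SW_L2 y1) a (SV_div qV) (SV_div rV)).
suff -> : boundary_inner (fun _ _ => y.2) (fun K E => normal_trace K E (a *: q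
  + r)) =
   a * boundary_inner (fun _ _ => y.2) (fun K E => normal_trace K E q) +
   boundary_inner (fun _ _ => y.2) (fun K E => normal_trace K E r) :> R by ring.
rewrite /boundary_inner mulr_sumr -big_split/=; apply: eq_bigr => K KT.
rewrite mulr_sumr -big_split/=; apply: eq_bigr => E EK.
rewrite (@eq_face_integral _ _ _ E _ (fun x => y.2 x *
    (a *: normal_trace K E q + normal_trace K E r) x)); last 2 first.
- exact: card_face EK.
- by move=> x Ex; rewrite normal_trace_linear.
apply: (semi_inner_linr (@face_square_integrable_subspace _ _ _ E)
  (@face_semi_inner _ _ _ E)).
- exact: (face_sq KT EK (SM_face y2 KT EK)).
- by apply: (face_sq KT EK); exact: normal_trace_polynomial.
- by apply: (face_sq KT EK); exact: normal_trace_polynomial.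
Qed.

Let integral0 E : face_integral E (fun=> 0) = 0 :> R.
Proof.
rewrite /face_integral Rintegral_cst ?mul0r ?mulr0//.
by apply: open_measurable_rV; exact: open_ref_simplex.
Qed.

Lemma grad_form_null y r : SY y -> SV r -> vinner T r r = 0 -> grad_form y r =
  0.
Proof.
move=> [y1 y2] rV r0.
have r0' := vinner_eq0 tri (fun i => Vh_pw_polynomial i rV) r0.
rewrite /grad_form.
rewrite (@eq_inner _ _ _ _ _ y.1 0); last first.
  by move=> K x KT Kx; rewrite (divergence0 tri (fun i pt => r0' i K pt KT))//.
rewrite (linear_on0 subL (semi_inner_linr subL gL (SW_L2 y1))) sub0r.
rewrite /boundary_inner big1 ?oppr0// => K KT; rewrite big1// => E EK.
rewrite -[RHS](integral0 E); apply: eq_face_integral => [|x Ex].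
  exact: card_face EK.
rewrite (normal_trace0 EK Ex) ?mulr0// => i pt Kpt; exact: r0' Kpt.
Qed.

(** [pj] is the jump that enters the stabilisation and [jump] the one without
    projection.  Only the latter is linear in y pointwise; both have the same
    products with polynomials of degree k. *)
Let pj K E y : point -> R := face_projection k E (trace K y.1) - y.2.
Let jump K y : point -> R := trace K y.1 - y.2.

Let trace_face K E y : SY y -> K \in cells T -> E \in faces_of K ->
  polynomial_on k.+1 (face E) (trace K y.1).
Proof.
by move=> [[_ y1] _] KT EK; apply: trace_polynomial => //; exact: y1.
Qed.

Let pj_polynomial K E y : SY y -> K \in cells T -> E \in faces_of K ->
  polynomial_on k (face E) (pj K E y).
Proof.
move=> yS KT EK; apply: linear_subspaceB (polynomial_on_subspace k (face E)) _
  _.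
  apply: (face_projectionP k (card_face EK) _).1.
  exact: (face_sq KT EK (trace_face yS KT EK)).
by case: yS => _ y2; exact: SM_face y2 KT EK.
Qed.

Let jump_sq K E y : SY y -> K \in cells T -> E \in faces_of K ->
  face_square_integrable E (jump K y).
Proof.
move=> yS KT EK; apply: linear_subspaceB (@face_square_integrable_subspace _ _
  _ E) _ _.
  exact: (face_sq KT EK (trace_face yS KT EK)).
by case: yS => _ y2; exact: (face_sq KT EK (SM_face y2 KT EK)).
Qed.

Let pj_jump K E y zeta : SY y -> K \in cells T -> E \in faces_of K ->
  polynomial_on k (face E) zeta ->
  face_inner E (pj K E y) zeta = face_inner E (jump K y) zeta.
Proof.
move=> yS KT EK pz; have gF := @face_semi_inner _ _ _ E;
  have subF := @face_square_integrable_subspace _ _ _ E.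
have sz := face_sq KT EK pz.
have str := face_sq KT EK (trace_face yS KT EK).
have [ppr prz] := face_projectionP k (card_face EK) str.
have sy2 : face_square_integrable E y.2.
  by case: yS => _ y2; exact: (face_sq KT EK (SM_face y2 KT EK)).
rewrite /pj /jump (linear_onB (semi_inner_linl gF sz))//;
  last exact: (face_sq KT EK ppr).
by rewrite prz// -(linear_onB (semi_inner_linl gF sz)).
Qed.

Let stabE y z : SY y -> SY z -> stab_form y z =
  \sum_(K in cells T) \sum_(E in faces_of K)
    (h K)^-1 * face_inner E (pj K E y) (pj K E z).
Proof.
move=> yS zS; apply: eq_bigr => K KT; apply: eq_bigr => E EK.
have gF := @face_semi_inner _ _ _ E; have subF :=
  @face_square_integrable_subspace _ _ _ E.
have sp y' : SY y' -> face_square_integrable E (pj K E y').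
  by move=> yS'; exact: (face_sq KT EK (pj_polynomial yS' KT EK)).
by rewrite -(linear_onZ subF (semi_inner_linl gF (sp _ zS)))//; exact: sp.
Qed.

(** Bilinearity is checked after replacing one projected jump by the plain one,
    symmetry and positivity on the projected ones. *)
Lemma stab_semi_inner : semi_inner SY stab_form.
Proof.
have hge0 K : 0 <= (h K)^-1 :> R.
  rewrite invr_ge0 /h /diam; set A := [set r | _].
  have [[A0 ubA]|noA] := pselect (has_sup A); last by rewrite sup_out.
  have [r Ar] := A0; rewrite (le_trans _ (ub_le_sup ubA Ar))//.
  by case: Ar => [x [y [_ _ ->]]]; exact: sqrtr_ge0.
split.
- move=> y z yS zS; rewrite !stabE//; apply: eq_bigr => K KT;
    apply: eq_bigr => E EK.
  congr (_ * _); apply: (semi_innerC (@face_semi_inner _ _ _ E)).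
    exact: (face_sq KT EK (pj_polynomial yS KT EK)).
  exact: (face_sq KT EK (pj_polynomial zS KT EK)).
- move=> z zS a y y' yS yS'.
  have yyS : SY (a *: y + y').
    by case: yS yS' => ? ? [? ?]; split;
      [apply: Wh_subspace.2|apply: Mh_subspace.2].
  rewrite !stabE// mulr_sumr -big_split/=; apply: eq_bigr => K KT.
  rewrite mulr_sumr -big_split/=; apply: eq_bigr => E EK.
  have pz := pj_polynomial zS KT EK.
  rewrite !pj_jump//.
  have -> : face_inner E (jump K (a *: y + y')) (pj K E z) =
     face_inner E (a *: jump K y + jump K y') (pj K E z).
    apply: eq_face_integral => [|x Ex]; first exact: card_face EK.
    congr (_ * _); rewrite /jump.
    have trl := trace_linear a KT EK Ex (Wh_pw_polynomial yS.1)
      (Wh_pw_polynomial yS'.1).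
    rewrite [LHS]/(trace K (a *: y.1 + y'.1) x - (a * y.2 x + y'.2 x)) trl.
    have regroup (t1 t2 v1 v2 : R) :
      a * t1 + t2 - (a * v1 + v2) = a * (t1 - v1) + (t2 - v2) by ring.
    exact: regroup.
  rewrite (semi_inner_linl (@face_semi_inner _ _ _ E)); last 3 first.
  + exact: (face_sq KT EK pz).
  + exact: jump_sq.
  + exact: jump_sq.
  by ring.
- move=> y yS; rewrite stabE// sumr_ge0// => K KT; rewrite sumr_ge0// => E EK.
  rewrite mulr_ge0//; apply: (semi_inner_ge0 (@face_semi_inner _ _ _ E)).
  exact: (face_sq KT EK (pj_polynomial yS KT EK)).
Qed.

(** Both forms only see a discrete function through its values on the open
    cells, which determine its traces, and on the faces. *)
Lemma forms_null y : SY y ->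
  (forall K x, K \in cells T -> cell K x -> y.1 x = 0) ->
  (forall E x, E \in faces T -> face E x -> y.2 x = 0) ->
  stab_form y y = 0 /\ forall r, SV r -> grad_form y r = 0.
Proof.
move=> yS u0 mu0; split=> [|r rV].
  rewrite stabE// big1// => K KT; rewrite big1// => E EK.
  rewrite pj_jump//; last exact: pj_polynomial.
  rewrite /face_inner (@eq_face_integral _ _ _ E _ (fun=> 0)) ?integral0
    ?mulr0//.
    exact: card_face EK.
  move=> x Ex; rewrite /jump [X in X * _](_ : _ = 0) ?mul0r//.
  have sub0 (a b : R) : a = 0 -> b = 0 -> a - b = 0.
    by move=> -> ->; rewrite subrr.
  apply: sub0; last exact: mu0 (faces_of_faces KT EK) Ex.
  exact: (trace0 EK Ex (fun pt => u0 K pt KT)).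
rewrite /grad_form (@eq_inner _ _ _ _ _ 0 (divergence r)); last first.
  by move=> K x KT Kx; rewrite (u0 K)// mul0r.
rewrite (linear_on0 subL (semi_inner_linl gL (SV_div rV))) sub0r.
rewrite /boundary_inner big1 ?oppr0// => K KT; rewrite big1// => E EK.
rewrite -[RHS](integral0 E); apply: eq_face_integral => [|x Ex].
  exact: card_face EK.
by rewrite (mu0 E) ?mul0r//; exact: faces_of_faces EK.
Qed.

End hdg_forms.

(** * The Cahn-Hilliard energy *)

Section polynomial_families.
Context (R : realType) (n : nat) (Omega : set 'rV[R]_n.+1) (T : mesh R n).
Hypothesis tri : triangulation T Omega.
Local Notation point := 'rV[R]_n.+1.

(** Families of functions depending polynomially on coordinates c.  They are
    closed under products, so the quartic energy is a polynomial in c. *)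
Definition polyfam b (A : 'rV[R]_b -> point -> R) : Prop :=
  exists (I : finType) (a : I -> 'rV[R]_b -> R) (F : I -> point -> R),
    [/\ forall i, polyfun (a i), forall i, pw_polynomial T (F i) &
        forall c, A c = \sum_i a i c *: F i].

Lemma polyfam_comb b (e : 'I_b -> point -> R) :
  (forall i, pw_polynomial T (e i)) -> polyfam (comb e).
Proof.
move=> pe; exists 'I_b, (fun i c => c ord0 i), e; split=> // i.
exact: polyfun_coord.
Qed.

Lemma polyfam_cst b w : pw_polynomial T w -> polyfam (fun _ : 'rV[R]_b => w).
Proof.
move=> pw; exists unit, (fun _ _ => 1), (fun=> w); split=> // [_|_].
  exact: polyfun_cst.
rewrite (eq_bigl (pred1 tt)); last by case.
by rewrite big_pred1_eq scale1r.
Qed.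

Lemma polyfamM b (A B : 'rV[R]_b -> point -> R) : polyfam A -> polyfam B ->
  polyfam (fun c x => A c x * B c x).
Proof.
move=> [I [a [F [pa pF AE]]]] [J [a' [F' [pa' pF' BE]]]].
exists (I * J)%type, (fun ij c => a ij.1 c * a' ij.2 c),
  (fun ij x => F ij.1 x * F' ij.2 x); split=> [ij|ij|c].
- exact: polyfunM.
- exact: pw_polynomialM.
- apply/funext => x; rewrite AE BE !fct_sumE big_distrlr/= pair_big/=.
  by apply: eq_bigr => ij _; rewrite mulrACA.
Qed.

Lemma polyfun_inner b (A B : 'rV[R]_b -> point -> R) : polyfam A -> polyfam B ->
  polyfun (fun c => inner T (A c) (B c)).
Proof.
move=> [I [a [F [pa pF AE]]]] [J [a' [F' [pa' pF' BE]]]].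
have subL := brokenL2_subspace tri; have gL := inner_semi_inner tri.
have LF i : brokenL2 T (F i) by exact: (pw_polynomial_brokenL2 tri).
have LF' j : brokenL2 T (F' j) by exact: (pw_polynomial_brokenL2 tri).
have LZ c i : brokenL2 T (a i c *: F i) by exact: (linear_subspaceZ _ subL (LF
  i)).
have LZ' c j : brokenL2 T (a' j c *: F' j) by exact: (linear_subspaceZ _ subL
  (LF' j)).
rewrite (_ : (fun _ => _) = fun c => \sum_i \sum_j
    (a i c * a' j c) * inner T (F i) (F' j)).
  apply: polyfun_sum => i; apply: polyfun_sum => j.
  by apply: polyfunM; [exact: polyfunM|exact: polyfun_cst].
apply/funext => c; rewrite AE BE.
have LB : brokenL2 T (\sum_j a' j c *: F' j) by exact: (linear_subspace_sum
  subL (LZ' c)).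
rewrite (linear_on_sum subL (semi_inner_linl gL LB))//; apply: eq_bigr => i _.
rewrite (linear_onZ subL (semi_inner_linl gL LB))//.
rewrite (linear_on_sum subL (semi_inner_linr subL gL (LF i)))// mulr_sumr.
apply: eq_bigr => j _.
by rewrite (linear_onZ subL (semi_inner_linr subL gL (LF i)))// mulrA.
Qed.

End polynomial_families.

Section cahn_hilliard_energy.
Context (R : realType) (n : nat) (Omega : set 'rV[R]_n.+1) (T : mesh R n).
Hypothesis tri : triangulation T Omega.
Local Notation point := 'rV[R]_n.+1.
Context (b : nat) (e : 'I_b -> point -> R).
Hypothesis pe : forall i, pw_polynomial T (e i).
Hypothesis e_orthonormal : forall i j, inner T (e i) (e j) = (i == j)%:R.
Implicit Types c d : 'rV[R]_b.

Local Notation U := (comb e).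
Let sq c : point -> R := fun x => U c x * U c x.
Let one : point -> R := fun=> 1.

(** The sum over the cells of the integral of u^4/4 - u^2/2, or of
    u^4/4 - u u' in the semi-implicit case, a primitive of the potential with
    respect to u. *)
Definition energy (f : nonlinearity) c' c : R :=
  1 / 4 * inner T (sq c) (sq c) -
  match f with
  | fully_implicit => 1 / 2 * inner T (U c) (U c)
  | semi_implicit => inner T (U c) (U c')
  end.

Definition potential_coords f c' c : 'rV[R]_b :=
  \row_i inner T (fun x => potential f (U c x) (U c' x)) (e i).

Let subL := brokenL2_subspace tri.
Let gL := inner_semi_inner tri.
Let pU c : pw_polynomial T (U c).
Proof. by apply: linear_subspace_comb => //; exact: pw_polynomial_subspace. Qed.
Let LU c : brokenL2 T (U c). Proof. exact: (pw_polynomial_brokenL2 tri). Qed.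
Let Lsq c : brokenL2 T (sq c). Proof. by apply: (pw_polynomial_brokenL2 tri);
  exact: pw_polynomialM. Qed.
Let Lone : brokenL2 T one. Proof. by apply: (pw_polynomial_brokenL2 tri);
  exact: pw_polynomial_cst. Qed.

Lemma potential_brokenL2 f c' c : brokenL2 T (fun x => potential f (U c x) (U
  c' x)).
Proof.
apply: (pw_polynomial_brokenL2 tri).
pose v := if f is fully_implicit then U c else U c'.
rewrite (_ : (fun _ => _) = -1 *: v + (fun x => U c x * sq c x)).
  apply: (pw_polynomial_subspace T).2; first by rewrite /v; case: (f).
  by apply: pw_polynomialM => //; exact: pw_polynomialM.
apply/funext => x; rewrite /potential /v.
have regroup (p q : R) : p ^+ 3 - q = -1 * q + p * (p * p) by ring.
by case: (f); exact: regroup.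
Qed.

Lemma inner_U c d : inner T (U c) (U d) = dotp c d.
Proof.
rewrite (linear_on_comb subL (semi_inner_linl gL (LU d)))//; last first.
  by move=> i; exact: (pw_polynomial_brokenL2 tri).
apply: eq_bigr => i _; congr (_ * _).
have Le j : brokenL2 T (e j) by exact: (pw_polynomial_brokenL2 tri).
rewrite (linear_on_comb subL (semi_inner_linr subL gL (Le i)))//.
rewrite (bigD1 i)//= big1 ?addr0 ?e_orthonormal ?eqxx ?mulr1// => j ji.
by rewrite e_orthonormal eq_sym (negbTE ji) mulr0.
Qed.

Lemma energy_polyfun f c' : polyfun (energy f c').
Proof.
have pfU := polyfam_comb pe.
have psq : polyfun (fun c => inner T (sq c) (sq c)).
  by apply: (polyfun_inner tri); exact: polyfamM.
case: f; rewrite /energy.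
  rewrite (_ : (fun _ => _) = fun c => 1 / 4 * inner T (sq c) (sq c) +
    - (1 / 2) * inner T (U c) (U c)); last by apply/funext => c; rewrite mulNr.
  apply: polyfunD; apply: polyfunM => //; try exact: polyfun_cst.
  exact: (polyfun_inner tri).
rewrite (_ : (fun _ => _) = fun c => 1 / 4 * inner T (sq c) (sq c) +
  -1 * inner T (U c) (U c')); last by apply/funext => c; rewrite mulN1r.
apply: polyfunD; apply: polyfunM => //; try exact: polyfun_cst.
by apply: (polyfun_inner tri) => //; exact: polyfam_cst.
Qed.

(** From (u^2 - 2)^2 >= 0, that is u^4/4 >= u^2 - 1, which absorbs the
    quadratic part, and 2 (u, u') <= (u, u) + (u', u') for the semi-implicit
    choice. *)
Lemma energy_coercive f c' : exists C, forall c, 1 / 2 * dotp c c - C <= energy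
  f c' c.
Proof.
exists (inner T one one + 1 / 2 * dotp c' c') => c.
have Lw : brokenL2 T (-2 *: one + sq c) by exact: subL.2.
have := semi_inner_ge0 gL Lw.
rewrite (semi_inner_linl gL)// !(semi_inner_linr subL gL)//.
have sqone : inner T (sq c) one = dotp c c.
  by rewrite -inner_U; apply: eq_inner => K x _ _; rewrite /one /sq mulr1.
rewrite (semi_innerC gL Lone)// sqone => quart.
have cc' : 0 <= dotp c c - 2 * dotp c c' + dotp c' c'.
  have -> : dotp c c - 2 * dotp c c' + dotp c' c' = dotp (c - c') (c - c').
    by rewrite dotpBl ![dotp _ (c - c')]dotpC !dotpBl (dotpC c' c); ring.
  by apply: sumr_ge0 => i _; rewrite -expr2 sqr_ge0.
have c'c' : 0 <= dotp c' c' by apply: sumr_ge0 => i _; rewrite -expr2 sqr_ge0.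
rewrite /energy; case: f; rewrite !inner_U; lra.
Qed.

(** Along a line the energy is a quartic polynomial whose linear coefficient is
    the potential tested with the direction. *)
Lemma energy_gradient f c' c d : exists a2 a3 a4, forall t,
  energy f c' (c + t *: d) = energy f c' c + t * dotp (potential_coords f c' c)
    d
  + t ^+ 2 * a2 + t ^+ 3 * a3 + t ^+ 4 * a4.
Proof.
pose uv : point -> R := fun x => U c x * U d x.
have Luv : brokenL2 T uv by apply: (pw_polynomial_brokenL2 tri);
  exact: pw_polynomialM.
have sqt t : sq (c + t *: d) = (2 * t) *: uv + (t ^+ 2 *: sq d + sq c).
  apply/funext => x.
  have UE : U (c + t *: d) x = t * U d x + U c x.
    by rewrite addrC comb_linear.
  have expand (p q : R) : (t * q + p) * (t * q + p) =
    2 * t * (p * q) + (t ^+ 2 * (q * q) + p * p) by ring.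
  by rewrite /sq UE expand.
have quart t : inner T (sq (c + t *: d)) (sq (c + t *: d)) =
    inner T (sq c) (sq c) + t * (4 * inner T (sq c) uv)
    + t ^+ 2 * (4 * inner T uv uv + 2 * inner T (sq c) (sq d))
    + t ^+ 3 * (4 * inner T uv (sq d)) + t ^+ 4 * inner T (sq d) (sq d).
  have Lin : brokenL2 T (t ^+ 2 *: sq d + sq c) by exact: subL.2.
  have Lt : brokenL2 T ((2 * t) *: uv + (t ^+ 2 *: sq d + sq c)) by exact:
    subL.2.
  rewrite sqt (semi_inner_linl gL Lt)// (semi_inner_linl gL Lt)//.
  rewrite !(semi_inner_linr subL gL _ _ _ Lin)// !(semi_inner_linr subL gL)//.
  rewrite (semi_innerC gL (Lsq d) (Lsq c)) (semi_innerC gL (Lsq c) Luv).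
  by rewrite (semi_innerC gL (Lsq d) Luv); ring.
have potE : dotp (potential_coords f c' c) d =
    inner T (fun x => potential f (U c x) (U c' x)) (U d).
  rewrite (linear_on_comb subL (semi_inner_linr subL gL (potential_brokenL2 _ _
    _)))//.
    by apply: eq_bigr => i _; rewrite mxE mulrC.
  by move=> i; exact: (pw_polynomial_brokenL2 tri).
pose c1 := if f is fully_implicit then c else c'.
have {}potE : dotp (potential_coords f c' c) d = inner T (sq c) uv - dotp c1 d.
  have Lc3 : brokenL2 T (fun x => U c x * sq c x).
    by apply: (pw_polynomial_brokenL2 tri); apply: pw_polynomialM => //;
      exact: pw_polynomialM.
  rewrite potE -inner_U (_ : (fun _ => _) = (fun x => U c x * sq c x) - U c1).
    rewrite (linear_onB (semi_inner_linl gL (LU d)))//; congr (_ - _).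
    by apply: eq_inner => K x _ _; rewrite /uv /sq; ring.
  apply/funext => x.
  have regroup (p q : R) : p ^+ 3 - q = p * (p * p) - q by ring.
  by rewrite /potential /c1; case: (f); exact: regroup.
exists (inner T uv uv + 1 / 2 * inner T (sq c) (sq d)
    - if f is fully_implicit then 1 / 2 * dotp d d else 0),
  (inner T uv (sq d)), (1 / 4 * inner T (sq d) (sq d)) => t.
rewrite /energy quart potE /c1; case: (f); rewrite !inner_U.
  rewrite !dotpDl !dotpZl ![dotp _ (c + _)]dotpC !dotpDl !dotpZl (dotpC d c).
  by field.
by rewrite !dotpDl !dotpZl (dotpC d c'); field.
Qed.

End cahn_hilliard_energy.

(** * Existence of a discrete solution *)

Section discrete_problem.
Context (R : realType) (n : nat) (Omega : set 'rV[R]_n.+1) (T : mesh R n) (k :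
  nat).
Hypotheses (tri : triangulation T Omega) (oO : open Omega).
Local Notation point := 'rV[R]_n.+1.
Local Notation SV := (Vh Omega T k).
Local Notation SW := (Wh Omega T k).
Local Notation SM := (Mh T k).

Let subL := brokenL2_subspace tri.
Let gL := inner_semi_inner tri.
Let subW := Wh_subspace T k oO.
Let gW := inner_Wh_semi_inner k tri.

Let SW_L2 u : SW u -> brokenL2 T u.
Proof. by move=> /Wh_pw_polynomial; exact: (pw_polynomial_brokenL2 tri). Qed.

Lemma Wh_basis_exists : exists b (e : 'I_b -> point -> R),
  orthonormal_basis SW (inner T) e.
Proof.
pose D (K : {set vertex T}) : set point := [set x | K \in cells T /\ cell K x].
pose ev (_ : {set vertex T}) (u : point -> R) := u.
apply: (@orthonormal_basis_exists _ _ _ _ (poly_coords k.+1 D ev)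
  #|{: {set vertex T} * mpoly.bmultinom n.+1 k.+2}| subW gW).
- split=> [a u w c d|u Wu u0]; first exact: poly_coords_linear.
  rewrite (@eq_inner _ _ _ _ _ 0 u).
    exact: (linear_on0 subL (semi_inner_linl gL (SW_L2 Wu))).
  move=> K x KT Kx; congr (_ * _).
  by apply: (poly_coords0 (D := D) (j := K) u0).
- move=> u [_ pu]; apply: poly_coords_exists => K.
  have [KT|KT] := boolP (K \in cells T).
    by have [p [sp up]] := pu _ KT; exists p; split=> // x [_ /up].
  exists 0; rewrite mpoly.msize0; split=> // x [KT'].
  by rewrite KT' in KT.
Qed.

Lemma Vh_basis_exists : exists a (v : 'I_a -> point -> point),
  orthonormal_basis SV (vinner T) v.
Proof.
pose D (j : {set vertex T} * 'I_n.+1) : set point :=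
  [set x | j.1 \in cells T /\ cell j.1 x].
pose ev (j : {set vertex T} * 'I_n.+1) (q : point -> point) := coordinate q j.2.
have evL j a q r x : ev j (a *: q + r) x = a * ev j q x + ev j r x.
  by rewrite /ev coordinate_linear.
apply: (@orthonormal_basis_exists _ _ _ _ (poly_coords k D ev)
  #|{: {set vertex T} * 'I_n.+1 * mpoly.bmultinom n.+1 k.+1}|
  (Vh_subspace T k oO) (vinner_Vh_semi_inner k tri)).
- split=> [a q r c d|q Vq q0]; first exact: poly_coords_linear.
  rewrite /vinner big1// => K KT.
  rewrite (@eq_Rintegral _ _ _ _ _ (fun=> 0)) ?Rintegral_cst ?mul0r//.
    exact: measurable_cell tri _ KT.
  move=> x /set_mem Kx; rewrite /dotp big1// => i _.
  by rewrite (_ : q x ord0 i = 0) ?mul0r//;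
    exact: (poly_coords0 (D := D) (j := (K, i)) q0).
- move=> q Vq; apply: poly_coords_exists => -[K i].
  have [KT|KT] := boolP (K \in cells T).
    by have [_ /(_ _ KT)[p [sp up]]] := Vq i; exists p; split=> // x [_ /up].
  exists 0; rewrite mpoly.msize0; split=> // x [KT'].
  by rewrite KT' in KT.
Qed.

Lemma Aform_condensation b (e : 'I_b -> point -> R) :
  orthonormal_basis SW (inner T) e ->
  exists2 L : 'M[R]_b, L^T = L /\
    (forall c : 'rV_b, 0 <= (c *m L *m c^T) ord0 ord0) &
  forall c : 'rV_b, exists q uhat, [/\ SV q, SM uhat &
    forall r w mu, SV r -> SW w -> SM mu ->
      Aform T k q (comb e c) uhat r w mu = inner T (comb e (c *m L)) w].
Proof.
move=> eS; have [a [v vS]] := Vh_basis_exists.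
pose D (E : {set vertex T}) : set point := [set x | E \in faces T /\ face E x].
pose ev (_ : {set vertex T}) (mu : point -> R) := mu.
have subM := Mh_subspace T k.
have SM0 : SM 0 by case: subM.
have SW0 : SW 0 by case: subW.
have [||||L Lsym LP] := @condensation R _ _ _ SV SW SM (vinner T) (inner T)
  (@grad_form R n T) (stab_form T k) (poly_coords k D ev)
  #|{: {set vertex T} * mpoly.bmultinom n.+1 k.+1}| a b v e
  (Vh_subspace T k oO) subW subM (vinner_Vh_semi_inner k tri) gW vS eS
  (fun r rV => grad_form_linearl tri rV) (fun y yS => grad_form_linearr tri yS)
  (fun y r yS rV => grad_form_null tri yS rV) (stab_semi_inner T k oO).
- move=> u uW u0; apply: (forms_null tri (y := (u, 0))) => // K x KT Kx.
  exact: (inner_eq0 tri (Wh_pw_polynomial uW) u0 KT Kx).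
- by move=> *; exact: poly_coords_linear.
- move=> mu /MhP pmu; apply: poly_coords_exists => E.
  have [ET|ET] := boolP (E \in faces T).
    by have [p [sp up]] := pmu _ ET; exists p; split=> // x [_ /up].
  exists 0; rewrite mpoly.msize0; split=> // x [ET'].
  by rewrite ET' in ET.
- move=> mu muM mu0; apply: (forms_null tri (y := (0, mu))) => // E x ET Ex.
  exact: (poly_coords0 (D := D) (j := E) mu0).
exists L => // c; have [q [uhat [qV uM quhat]]] := LP c.
by exists q, uhat; split=> // r w mu rV wW muM; rewrite AformE quhat.
Qed.

End discrete_problem.

Theorem theorem4p1 (R : realType) (d' : nat) (hd : d'.+1 = 2%N \/ d'.+1 = 3%N)
  (Omega : set 'rV[R]_d'.+1) (hOmega : polyhedral_Lipschitz_domain Omega)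
  (Th : mesh R d') (hTh : triangulation Th Omega)
  (sigma tau : R) (hsigma : shape_regular Th sigma) (htau : quasi_uniform Th tau)
  (k : nat) (epsilon tfinal : R) (hepsilon : 0 < epsilon) (htfinal : 0 < tfinal)
  (u0 : 'rV[R]_d'.+1 -> R) (hu0 : square_integrable Omega u0)
  (N : nat) (hN : (1 <= N)%N) (f : nonlinearity) :
  let dt := tfinal / N%:R in
  exists (p q : nat -> 'rV[R]_d'.+1 -> 'rV[R]_d'.+1)
         (phi u phihat uhat : nat -> 'rV[R]_d'.+1 -> R),
  [/\ Wh Omega Th k (u 0%N),
      forall w3, Wh Omega Th k w3 -> inner Th (u 0%N) w3 - inner Th u0 w3 = 0 &
      forall n : nat, (1 <= n <= N)%N ->
      [/\ [/\ Vh Omega Th k (p n), Wh Omega Th k (phi n) & Mh Th k (phihat n)],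
          [/\ Vh Omega Th k (q n), Wh Omega Th k (u n) & Mh Th k (uhat n)],
          forall r1 w1 mu1,
            Vh Omega Th k r1 -> Wh Omega Th k w1 -> Mh Th k mu1 ->
            inner Th (fun x => (u n x - u n.-1 x) / dt) w1
            + Aform Th k (p n) (phi n) (phihat n) r1 w1 mu1 = 0 &
          forall r2 w2 mu2,
            Vh Omega Th k r2 -> Wh Omega Th k w2 -> Mh Th k mu2 ->
            inner Th (fun x => epsilon^-1 * potential f (u n x) (u n.-1 x)) w2
            + epsilon * Aform Th k (q n) (u n) (uhat n) r2 w2 mu2
            - inner Th (phi n) w2 = 0]].
Proof.
move=> dt.
have oO : open Omega by case: hOmega => -[].
have dt0 : 0 < dt by rewrite divr_gt0// ltr0n.
have subL := brokenL2_subspace hTh; have gL := inner_semi_inner hTh.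
have subW := Wh_subspace Th k oO; have gW := inner_Wh_semi_inner k hTh.
have WL w : Wh Omega Th k w -> brokenL2 Th w by move=> /Wh_pw_polynomial;
  exact: (pw_polynomial_brokenL2 hTh).
have [b [e eS]] := Wh_basis_exists k hTh oO.
have [We e_orthonormal _] := eS.
have [L [Lsym Lpos] /choice[Q QP]] := Aform_condensation hTh oO eS.
have [uh QuhP] := choice QP.
pose U := comb e.
have WU c : Wh Omega Th k (U c) by exact: linear_subspace_comb.
have LU c : brokenL2 Th (U c) by exact: WL.
have pe i : pw_polynomial Th (e i) by exact: Wh_pw_polynomial (We i).
(* a function and its projection onto W_h cannot be told apart by W_h *)
have testW g w : brokenL2 Th g -> Wh Omega Th k w ->
    inner Th (U (\row_i inner Th g (e i))) w = inner Th g w.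
  move=> Lg Ww; apply: (riesz subW gW eS (l := inner Th g)) => //.
  - by move=> a v1 v2 /WL Lv1 /WL Lv2; exact: (semi_inner_linr subL gL).
  - move=> v /WL Lv v0; rewrite (semi_innerC gL)//.
    exact: (semi_inner_null subL gL).
have step c' : exists cd : 'rV[R]_b * 'rV[R]_b,
    cd.1 - c' + dt *: (cd.2 *m L) = 0 /\
    cd.2 = epsilon^-1 *: potential_coords Th e f c' cd.1 + epsilon *: (cd.1 *m
      L).
  have [C coer] := energy_coercive hTh pe e_orthonormal f c'.
  have [|||c [d [cd1 cd2]]] := @implicit_gradient_step R b L Lsym _
    (energy Th e f c') (potential_coords Th e f c') (1 / 2) C _ coer _
    (energy_gradient hTh pe e_orthonormal f c') dt epsilon c' dt0 hepsilon.
  - by move=> x; rewrite dotpE; exact: Lpos.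
  - exact: (energy_polyfun hTh pe f c').
  - by [].
  by exists (c, d).
have [S SP] := choice step.
pose c0 : 'rV[R]_b := \row_i inner Th u0 (e i).
pose cs n := iter n (fun c => (S c).1) c0.
pose ds n := (S (cs n.-1)).2.
exists (Q \o ds), (Q \o cs), (U \o ds), (U \o cs), (uh \o ds), (uh \o cs).
split=> [|w3 Ww3|n /andP[n0 _]] /=; first exact: WU.
  by rewrite testW ?subrr//; exact: (brokenL2_restrict hTh oO).
have [Vp Mp pE] := QuhP (ds n); have [Vq Mq qE] := QuhP (cs n).
have [] := SP (cs n.-1); rewrite -/(ds n).
have -> : (S (cs n.-1)).1 = cs n by case: n n0 {Vp Mp pE Vq Mq qE}.
set c := cs n; set c' := cs n.-1; set d := ds n => mass dE.
split=> //.
- move=> r1 w1 mu1 Vr1 Ww1 Mmu1; rewrite pE//.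
  have -> : (fun x => (U c x - U c' x) / dt) = U (dt^-1 *: (c - c')).
    by rewrite /U combZ combB; apply/funext => x; rewrite mulrC.
  rewrite -(linear_onD (semi_inner_linl gL (WL _ Ww1)) (LU _) (LU _)) -combD.
  have -> : dt^-1 *: (c - c') + d *m L = dt^-1 *: (c - c' + dt *: (d *m L)).
    by rewrite [RHS]scalerDr scalerA mulVf ?scale1r// gt_eqF.
  by rewrite mass scaler0 comb0 (linear_on0 subL (semi_inner_linl gL (WL _
    Ww1))).
- move=> r2 w2 mu2 Vr2 Ww2 Mmu2; rewrite qE//.
  have Lpot := potential_brokenL2 hTh pe f c' c.
  have innerZ := linear_onZ subL (semi_inner_linl gL (WL _ Ww2)).
  have innerD := linear_onD (semi_inner_linl gL (WL _ Ww2)).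
  rewrite (innerZ _ _ Lpot) -(testW _ _ Lpot Ww2) dE /U combD innerD;
    last 2 first.
  - exact: LU.
  - exact: LU.
  by rewrite !combZ !innerZ ?subrr; [ | exact: LU | exact: LU].
Qed.
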